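(* Let $d\geqslant 8$. For every admissible monomial $x$ of weight vector $(4)|^2|(3)|^{d-4}$ in $P_5$ there is a unique triple $J_x=(j_1^x,j_2^x,j_3^x)$ with $1\le j_1^x<j_2^x<j_3^x\le5$ such that $\nu_{j_s^x}(x)>32$ for $s=1,2,3$. Moreover, the set of admissible monomials of weight vector $(4)|^2|(3)|^{d-4}|(1)$ in $P_5$ is exactly $$\Big\{\,x\,x_{j_u^x}^{2^{d-2}}\;:\;x \text{ admissible of weight vector }(4)|^2|(3)|^{d-4}\text{ in }P_5,\ u=1,2,3\Big\},$$ and $\dim QP_5((4)|^2|(3)|^{d-4}|(1))=1395$.
   Context: $P_k=\mathbb F_2[x_1,\dots,x_k]$, $\deg x_i=1$, with the standard action of the mod-2 Steenrod algebra $\mathcal A$; $\mathcal A^+$ is the augmentation ideal. For a monomial $x$, $\nu_j(x)$ is the exponent of $x_j$, $\alpha_i(a)$ the $i$-th binary digit of $a$, $\omega(x)=(\omega_i(x))$ with $\omega_i(x)=\sum_j\alpha_{i-1}(\nu_j(x))$, $\sigma(x)=(\nu_1(x),\dots,\nu_k(x))$, both ordered left-lexicographically; for monomials of equal degree $u<v$ iff $\omega(u)<\omega(v)$, or $\omega(u)=\omega(v)$ and $\sigma(u)<\sigma(v)$. A monomial $u$ is admissible unless there are monomials $v_1,\dots,v_r<u$ with $u+\sum v_j\in\mathcal A^+P_k$. For a weight vector $\omega$ with $\deg\omega=\sum_i2^{i-1}\omega_i$: $P_k(\omega)$ (resp. $P_k^-(\omega)$) is spanned by monomials $y$ of degree $\deg\omega$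 with $\omega(y)\le\omega$ (resp. $<\omega$), and $QP_k(\omega)=P_k(\omega)/((\mathcal A^+P_k\cap P_k(\omega))+P_k^-(\omega))$. Notation: $|$ is concatenation, $(a)|^r$ is $a$ repeated $r$ times, remaining entries $0$; so $(4)|^2|(3)|^{d-4}|(1)=(4,4,3,\dots,3,1,0,\dots)$ with $d-4$ threes. *)

(* Defs.v *)
From HB Require Import structures.
From mathcomp Require Import all_boot all_order all_algebra.
From mathcomp Require Import mpoly.
Set Implicit Arguments. Unset Strict Implicit. Unset Printing Implicit Defensive.
Import Order.TTheory GRing.Theory.
Local Open Scope ring_scope.

(* The polynomial algebra P_k over F_2; variables are indexed by 'I_k
   (the paper's x_j, 1 <= j <= k, is our 'X_(j-1)). *)
Notation Pk k := {mpoly 'F_2[k]}.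

(* On a monomial x^a: Cartan formula with Sq^i(x_j^e) = C(e,i) x_j^(e+i):
   Sq^i(x^a) = sum_{b, |b| = i} (prod_j C(a_j,b_j)) x^(a+b). *)
Definition Sq_mon (k i : nat) (a : 'X_{1..k}) : Pk k :=
  \sum_(b : 'X_{1..k < i.+1} | mdeg b == i)
     ((\prod_(j < k) 'C(a j, b j))%N)%:R *: 'X_[(a + b)%MM].

Definition Sq (k i : nat) (p : Pk k) : Pk k :=
  \sum_(a <- msupp p) p@_a *: Sq_mon i a.

Definition Sq_word (k : nat) (w : seq nat) (p : Pk k) : Pk k :=
  foldr (fun i q => Sq i q) p w.

(* A^+ is spanned (as an F_2-space) by the nonempty products of the
   generators Sq^i, i > 0; hence A^+ P_k is the set of finite sums of
   terms theta(f) with theta such a product and f in P_k. *)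
Definition in_AplusP (k : nat) (p : Pk k) : Prop :=
  exists s : seq (seq nat * Pk k),
    [/\ all (fun wf => (wf.1 != [::]) && all (fun i => 0 < i)%N wf.1) s
      & p = \sum_(wf <- s) Sq_word wf.1 wf.2].

Definition alpha (i a : nat) : nat := odd (a %/ 2 ^ i).

(* omega(x) as a function nat -> nat, shifted by one:
   omega x i = omega_{i+1}(x) = sum_j alpha_i(nu_j(x)). *)
Definition omega (k : nat) (x : 'X_{1..k}) (i : nat) : nat :=
  (\sum_(j < k) alpha i (x j))%N.

Definition sigma (k : nat) (x : 'X_{1..k}) (j : nat) : nat :=
  nth 0%N (val x) j.

(* A weight vector is given by the finite list of its entries
   (omega_1, omega_2, ...), the remaining entries being 0. *)
Definition wfun (w : seq nat) (i : nat) : nat := nth 0%N w i.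
Definition degw (w : seq nat) : nat := (\sum_(i < size w) 2 ^ i * nth 0 w i)%N.

Definition ltlex (f g : nat -> nat) : Prop :=
  exists i, (forall l, (l < i)%N -> f l = g l) /\ (f i < g i)%N.
Definition lelex (f g : nat -> nat) : Prop := ltlex f g \/ f =1 g.

Definition mlt (k : nat) (u v : 'X_{1..k}) : Prop :=
  mdeg u = mdeg v /\
  (ltlex (omega u) (omega v) \/
   (omega u =1 omega v /\ ltlex (sigma u) (sigma v))).

Definition has_weight (k : nat) (x : 'X_{1..k}) (w : seq nat) : Prop :=
  omega x =1 wfun w.

Definition admissible (k : nat) (u : 'X_{1..k}) : Prop :=
  ~ exists vs : seq 'X_{1..k},
      (forall v, v \in vs -> mlt v u) /\
      in_AplusP ('X_[u] + \sum_(v <- vs) 'X_[v] : Pk k).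

Definition in_Pw (k : nat) (w : seq nat) (p : Pk k) : Prop :=
  forall y, y \in msupp p -> mdeg y = degw w /\ lelex (omega y) (wfun w).
Definition in_Pw_minus (k : nat) (w : seq nat) (p : Pk k) : Prop :=
  forall y, y \in msupp p -> mdeg y = degw w /\ ltlex (omega y) (wfun w).

Definition in_Wsub (k : nat) (w : seq nat) (p : Pk k) : Prop :=
  exists q r, [/\ in_AplusP q, in_Pw w q, in_Pw_minus w r & p = q + r].

(* dim QP_k(omega) = n : there is a family of n elements of P_k(omega)
   whose classes form a basis of the quotient P_k(omega)/W (over F_2 the
   linear combinations are exactly the subfamily sums). *)
Definition dimQP_is (k : nat) (w : seq nat) (n : nat) : Prop :=
  exists s : seq (Pk k),
    [/\ size s = n,
        forall b, b \in s -> in_Pw w b,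
        (forall m : bitseq, size m = n -> has id m ->
           ~ in_Wsub w (\sum_(b <- mask m s) b))
      & (forall p, in_Pw w p -> exists m : bitseq,
           in_Wsub w (p - \sum_(b <- mask m s) b))].

Definition w1 (d : nat) : seq nat := [:: 4; 4] ++ nseq (d - 4) 3.
Definition w2 (d : nat) : seq nat := w1 d ++ [:: 1].

Definition good_triple (x : 'X_{1..5}) (J : 'I_5 * 'I_5 * 'I_5) : Prop :=
  [/\ (J.1.1 < J.1.2)%N, (J.1.2 < J.2)%N,
      (32 < x J.1.1)%N, (32 < x J.1.2)%N & (32 < x J.2)%N].

(* Main.v *)
(* A monomial is a word whose i-th letter is the set of variables with i-th
   binary exponent digit 1; the weight vector lists the sizes of the letters.
   Modulo hit polynomials and lower weights, Sq^(2^r) of a monomial is a sum over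
   the variables c with r-th digit 1 of the monomials with 2^r added to the
   exponent of c, and such a relation survives arbitrary further digits below and
   above.  Finitely many of these relations rewrite every word of weight
   (4,4,3,3,3,3) to one of 465 normal words, and make every letter following
   repetitions of the last letter J of a normal word b reducible, except J itself
   and the singletons contained in J.  The classes are thus spanned by the words
   b J ... J and b J ... J {j} with j in J; the variables with exponent > 32 in b
   are exactly the elements of J.
   Conversely, the coefficient of a spike, precomposed with a linear substitution
   of the variables, vanishes on hit polynomials, and its value at a word is a
   product of minors over F_2.  Substitutions given by matrices adapted to J make
   the pairing with the standard words block triangular in J, with diagonal blocks
   of full rank. *)

Require Import Defs.
From HB Require Import structures.
From mathcomp Require Import all_boot all_order all_algebra.
From mathcomp Require Import mpoly zify.
Set Implicit Arguments. Unset Strict Implicit. Unset Printing Implicit Defensive.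
Import Order.TTheory GRing.Theory.
Local Open Scope ring_scope.

(** The obstacle is uniformity in d. With d = 8 + t, words of the first weight have 6 + t letters,
    so d = 8 is the six-letter case that is computed, and 32 is the value of the sixth digit.
    Passing to larger t costs nothing on either side: a deviation from the repeated letter J is
    reducible wherever it occurs, and every further J multiplies the value of a word by a minor that
    is 1 as soon as the value of the six-letter part is nonzero. Each rewriting keeps the weight and
    lowers sigma. Therefore the irreducible words, once independent modulo hits and lower weights,
    are not just some basis but exactly the admissible monomials; the set and the dimension 1395 = 3
    * 465 come out together. Spike coefficients kill hits because the total Steenrod square is the
    ring endomorphism x |-> x + x^2: it commutes with linear substitutions and leaves coefficients
    of spikes unchanged. The spikes live in four variables because they share the weight of the
    words, whose largest letters have four elements. *)

Lemma natrF2 (n : nat) : n%:R = (odd n)%:R :> 'F_2.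
Proof.
by rewrite -(GRing.natr_mod_pchar (pchar_Fp (isT : prime 2))) modn2.
Qed.

Lemma F2_neq0 (x : 'F_2) : x != 0 -> x = 1.
Proof. by case: x => [[|[|//]] ?] //= _; apply/val_inj. Qed.

Section F2poly.
Variable k : nat.
Implicit Types p q : Pk k.

Lemma addpp p : p + p = 0.
Proof.
by apply/mpolyP=> m; rewrite mcoeffD mcoeff0; apply: (addrr_pchar2 (pchar_Fp _)).
Qed.

Lemma oppp p : - p = p.
Proof. by apply/eqP; rewrite eq_sym -addr_eq0 addpp. Qed.

Lemma mpoly_suppE p : p = \sum_(m <- msupp p) 'X_[m].
Proof.
rewrite {1}[p]mpolyE; apply: eq_big_seq => m.
by rewrite mcoeff_msupp => /F2_neq0 ->; rewrite scale1r.
Qed.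

End F2poly.

(** * Parity of binomial coefficients and binary digits *)

Lemma odd_binSS n m : odd 'C(n.+2, m.+2) = odd 'C(n, m.+2) (+) odd 'C(n, m).
Proof. by rewrite !binS !oddD; case: (odd 'C(n, m.+1)); do 2 case: (odd _). Qed.

(** Lucas's theorem at 2 for the lowest digit; the induction rests on (1 + X)^2 = 1 + X^2, which is
    [odd_binSS]. *)
Lemma odd_bin_double n m (e f : bool) :
  odd 'C(n.*2 + e, m.*2 + f) = odd 'C(n, m) && (f ==> e).
Proof.
elim: n m => [|n IHn] m.
  by case: m => [|m]; case: e; case: f; rewrite ?bin0 ?doubleS ?addSn ?bin0n ?bin1 //= binS !bin0n.
case: m => [|m].
  clear IHn; rewrite bin0 double0 add0n; case: f; last by rewrite bin0.
  by rewrite bin1 oddD odd_double; case: e.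
rewrite !doubleS !addSn odd_binSS -2!addSn -doubleS !IHn binS oddD.
by case: (odd 'C(n, m.+1)); case: (odd 'C(n, m)); case: (f ==> e).
Qed.

Lemma odd_bin_half n m :
  odd 'C(n, m) = odd 'C(n./2, m./2) && (odd m ==> odd n).
Proof.
by rewrite -{1}[n]odd_double_half -{1}[m]odd_double_half ![(nat_of_bool _ + _)%N]addnC
  odd_bin_double.
Qed.

Lemma half_exp t q : (2 ^ t.+1 * q)./2 = (2 ^ t * q)%N.
Proof. by rewrite expnS -mulnA mul2n doubleK. Qed.

(** The lowest digit 1 of 2^t q is at position t, and Lucas's theorem forces [a] to have the digit 1
    there too. *)
Lemma odd_bin_bit t q a : odd q -> odd 'C(a, 2 ^ t * q) -> odd (a %/ 2 ^ t).
Proof.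
move=> qodd; elim: t a => [|t IHt] a.
  by rewrite expn0 mul1n divn1 odd_bin_half qodd => /andP[].
rewrite odd_bin_half half_exp; case/andP=> /IHt + _.
by rewrite -divn2 -divnMA -expnS.
Qed.

Lemma odd_bin_pow2 t a : odd 'C(a, 2 ^ t) = odd (a %/ 2 ^ t).
Proof.
elim: t a => [|t IHt] a; first by rewrite bin1 divn1.
rewrite odd_bin_half -[(2 ^ t.+1)%N]muln1 half_exp muln1 IHt muln1 oddX /=.
by rewrite andbT -divn2 -divnMA -expnS.
Qed.

Lemma alpha_add_low l t q a : (l < t)%N -> alpha l (a + 2 ^ t * q) = alpha l a.
Proof.
move=> lt_lt; rewrite /alpha -(subnKC (ltnW lt_lt)) expnD -mulnA.
rewrite divnDr ?dvdn_mulr // mulKn ?expn_gt0 // oddD oddM oddX.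
by rewrite subn_eq0 leqNgt lt_lt addbF.
Qed.

Lemma alpha_add_at t q a :
  alpha t (a + 2 ^ t * q) = odd (a %/ 2 ^ t) (+) odd q :> nat.
Proof. by rewrite /alpha divnDr ?dvdn_mulr // mulKn ?expn_gt0 // oddD. Qed.

(** * Steenrod squares of monomials modulo lower weights *)

Section Hits.
Variable k : nat.
Implicit Types (p q : Pk k) (a b y : 'X_{1..k}).

Lemma in_AplusP0 : in_AplusP (0 : Pk k).
Proof. by exists [::]; split=> //; rewrite big_nil. Qed.

Lemma in_AplusPD p q : in_AplusP p -> in_AplusP q -> in_AplusP (p + q).
Proof.
move=> [s [s_ok ->]] [t [t_ok ->]].
by exists (s ++ t); split; [rewrite all_cat s_ok | rewrite big_cat].
Qed.

Lemma in_AplusP_Sq i p : (0 < i)%N -> in_AplusP (Sq i p).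
Proof.
by move=> i_gt0; exists [:: ([:: i], p)]; split; rewrite /= ?i_gt0 ?big_seq1.
Qed.

Lemma Sq_X i a : Sq i ('X_[a] : Pk k) = Sq_mon i a.
Proof. by rewrite /Sq msuppX big_seq1 mcoeffX eqxx scale1r. Qed.

Lemma mcoeff_Sq_mon i a y :
  (Sq_mon i a)@_y =
  ((a <= y)%MM && (mdeg (y - a)%MM == i) &&
   odd (\prod_(j < k) 'C(a j, (y - a)%MM j)))%:R.
Proof.
rewrite /Sq_mon raddf_sum /=.
under eq_bigr => b _ do rewrite mcoeffZ mcoeffX.
case: (boolP ((a <= y)%MM && _)) => [/andP[le_ay /eqP deg_ya]|nle]; last first.
  rewrite big1 //= => b /eqP deg_b; case: eqP => [yE|_]; last by rewrite mulr0.
  by case/negP: nle; rewrite -yE lem_addr /= [(a + _)%MM]addmC addmK deg_b.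
have lt_ya : (mdeg (y - a)%MM < i.+1)%N by rewrite deg_ya.
rewrite (bigD1 (BMultinom lt_ya)) /= ?deg_ya //.
have rest (b : 'X_{1..k < i.+1}) : (mdeg b == i) && (b != BMultinom lt_ya) ->
    (\prod_(j < k) 'C(a j, b j))%:R * ((a + b)%MM == y)%:R = 0 :> 'F_2.
  case/andP=> _ ne_b; case: eqP => [yE|_]; last by rewrite mulr0.
  by case/eqP: ne_b; apply/val_inj; rewrite /= -yE [(a + _)%MM]addmC addmK.
rewrite (big1 _ _ _ rest) addr0; by rewrite [(a + _)%MM]addmC submK // eqxx mulr1 natrF2.
Qed.

Lemma odd_prod (I : finType) (F : I -> nat) (j : I) :
  odd (\prod_i F i) -> odd (F j).
Proof. by rewrite (bigD1 j) //= oddM; case/andP. Qed.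

(** A lexicographic drop whose position is bounded: below r the monomial being squared still has the
    target weight, so such a drop is a drop with respect to the target. *)
Definition drops_below r (f g : nat -> nat) :=
  exists t, [/\ (t < r)%N, (forall l, (l < t)%N -> f l = g l) & (f t < g t)%N].

(** Let 2^t be the largest power of 2 dividing all entries of [b]; then t <= r. If t = r, the degree
    leaves room for a single entry 2^r. If t < r, every odd b_j / 2^t meets a digit 1 of a_j by
    Lucas, so adding [b] clears digits at position t, creates none there and leaves the lower ones
    alone. *)
Lemma odd_bin_drops r a b :
  mdeg b = (2 ^ r)%N -> odd (\prod_(j < k) 'C(a j, b j)) ->
  (exists c : 'I_k, b = (U_(c) *+ 2 ^ r)%MM) \/
  drops_below r (omega (a + b)%MM) (omega a).
Proof.
move=> deg_b Codd.
pose P t := [forall j : 'I_k, 2 ^ t %| b j]%N.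
have P0 : exists t, P t by exists 0%N; apply/forallP=> j; rewrite expn0 dvd1n.
have Ple t : P t -> (t <= r)%N.
  move=> /forallP Pt; have: (2 ^ t %| 2 ^ r)%N.
    by rewrite -deg_b mdegE; apply: dvdn_sum => j _.
  by rewrite dvdn_Pexp2l.
case: (ex_maxnP P0 Ple) => t /forallP Pt tmax.
have bE j : b j = (2 ^ t * (b j %/ 2 ^ t))%N by rewrite mulnC divnK.
have := Ple t (introT forallP Pt); rewrite leq_eqVlt => /orP[/eqP tr|lt_tr].
  left; subst t; have sum1 : (\sum_(j < k) b j %/ 2 ^ r = 1)%N.
    apply/eqP; rewrite -(eqn_pmul2l (expn_gt0 2 r : _ = true)) muln1 -{3}deg_b mdegE.
    by rewrite big_distrr /=; apply/eqP/eq_bigr => j _; rewrite -bE.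
  have [c c1] : exists c : 'I_k, (0 < b c %/ 2 ^ r)%N.
    apply/existsP; apply/contraT; rewrite negb_exists => /forallP b0.
    by move: sum1; rewrite big1 // => j _; apply/eqP; rewrite -leqn0 leqNgt.
  exists c; apply/mnmP=> j; rewrite mulmnE mnm1E bE.
  move: sum1; rewrite (bigD1 c) //= => sum1.
  have c1' : (b c %/ 2 ^ r = 1)%N
    by apply/eqP; rewrite eqn_leq c1 andbT -[leqRHS]sum1 leq_addr.
  case: eqP => [<-|/eqP ne_cj]; first by rewrite c1' mul1n muln1.
  have: (\sum_(i < k | i != c) b i %/ 2 ^ r = 0)%N.
    by apply/eqP; rewrite -(eqn_add2l 1) -{1}c1' sum1.
  move/eqP; rewrite sum_nat_eq0 => /forallP /(_ j); rewrite eq_sym ne_cj /= => /eqP ->.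
  by rewrite muln0 mul0n.
right; exists t; split=> //.
  by move=> l lt_lt; apply: eq_bigr => j _; rewrite mnmDE (bE j) alpha_add_low.
have [c oddc] : exists c : 'I_k, odd (b c %/ 2 ^ t).
  have: ~~ P t.+1 by apply/negP => /tmax; rewrite ltnn.
  rewrite negb_forall => /existsP[c nd]; exists c; apply/contraR: nd => ev.
  by rewrite expnSr (bE c) dvdn_pmul2l ?expn_gt0 // dvdn2.
have bit j : odd (b j %/ 2 ^ t) -> odd (a j %/ 2 ^ t).
  move=> oddj; apply: (odd_bin_bit oddj); rewrite -bE.
  exact: (odd_prod (F := fun j => 'C(a j, b j)) j Codd).
rewrite /omega (bigD1 c) //= [ltnRHS](bigD1 c) //= -addSn leq_add //.
  by rewrite mnmDE (bE c) alpha_add_at /alpha oddc (bit c oddc).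
apply: leq_sum => j _; rewrite mnmDE (bE j) alpha_add_at /alpha.
by case: (boolP (odd (b j %/ 2 ^ t))) => [/bit ->|]; rewrite ?addbF.
Qed.

(** The term adding 2^r to the exponent of c has coefficient C(a_c, 2^r), whose parity is the r-th
    digit of a_c; all other terms drop in weight by [odd_bin_drops]. *)
Lemma Sq_pow2 r a : exists low : Pk k,
  Sq (2 ^ r) ('X_[a] : Pk k) =
    \sum_(c < k | odd (a c %/ 2 ^ r)) 'X_[a + U_(c) *+ 2 ^ r] + low
  /\ forall y, y \in msupp low ->
       mdeg y = (mdeg a + 2 ^ r)%N /\ drops_below r (omega y) (omega a).
Proof.
set T := \sum_(c < k | _) _; exists (Sq (2 ^ r) 'X_[a] - T).
split=> [|y]; first by rewrite addrC subrK.
rewrite Sq_X mcoeff_msupp mcoeffB mcoeff_Sq_mon.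
have degU (c : 'I_k) : mdeg (U_(c) *+ 2 ^ r)%MM = (2 ^ r)%N by rewrite mdegMn mdeg1 mul1n.
have odd1 c : odd (\prod_(j < k) 'C(a j, (U_(c) *+ 2 ^ r)%MM j)) = odd (a c %/ 2 ^ r).
  rewrite (bigD1 c) //= big1 ?muln1 => [|j ne_jc].
    by rewrite mulmnE mnm1E eqxx mul1n odd_bin_pow2.
  by rewrite mulmnE mnm1E eq_sym (negPf ne_jc) mul0n bin0.
have Ty c : T@_(a + U_(c) *+ 2 ^ r)%MM = (odd (a c %/ 2 ^ r))%:R.
  rewrite /T raddf_sum /= big_mkcond (bigD1 c) //= big1 ?addr0 => [|j ne_jc].
    by case: ifP => _; rewrite ?mcoeffX ?eqxx.
  case: ifP => // _; rewrite mcoeffX; case: eqP => // /mnmP/(_ j).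
  rewrite !mnmDE !mulmnE !mnm1E eqxx eq_sym (negPf ne_jc) mul0n mul1n.
  by have := expn_gt0 2 r; lia.
have Tsupp : T@_y != 0 ->
    exists2 c, odd (a c %/ 2 ^ r) & y = (a + U_(c) *+ 2 ^ r)%MM.
  rewrite /T raddf_sum /= => Ty0;
  have [c /andP[bitc /eqP yE]|nex] := pickP (fun c : 'I_k =>
    odd (a c %/ 2 ^ r) && (y == (a + U_(c) *+ 2 ^ r)%MM)); first by exists c.
  case/eqP: Ty0; apply: big1 => c bitc; rewrite mcoeffX; case: eqP => // yE.
  by have := nex c; rewrite bitc yE eqxx.
have subU c : (a + U_(c) *+ 2 ^ r - a)%MM = (U_(c) *+ 2 ^ r)%MM.
  by rewrite [(a + _)%MM]addmC addmK.
case: (boolP ((a <= y)%MM && _)) => [/andP[le_ay /eqP deg_ya]|nle] /=; last first.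
  rewrite sub0r oppr_eq0 => /Tsupp[c _ yE].
  by case/negP: nle; rewrite yE lem_addr /= subU degU.
have yE : y = (a + (y - a))%MM by rewrite addmC submK.
case: (boolP (odd _)) => [Codd|Cev]; last first.
  rewrite sub0r oppr_eq0 => /Tsupp[c bitc yE'].
  by move: Cev; rewrite yE' subU odd1 bitc.
case: (odd_bin_drops deg_ya Codd) => [[c bE]|drops]; last first.
  by split; [rewrite yE mdegD deg_ya | rewrite yE].
by rewrite yE bE Ty -odd1 -bE Codd subrr eqxx.
Qed.

End Hits.

(** * Monomials as words of binary digits *)

(* Letters are indicator sequences of sets of variables; the lowest digit comes
   first. *)
Notation word := (seq bitseq).

Definition expo (w : word) (c : nat) : nat :=
  foldr (fun (l : bitseq) e => nth false l c + e.*2)%N 0%N w.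

Definition prof (w : word) : seq nat := map (count id) w.

Definition wf (k : nat) (w : word) := all (fun l : bitseq => size l == k) w.

Lemma wf_cat k u v : wf k (u ++ v) = wf k u && wf k v.
Proof. exact: all_cat. Qed.

Lemma prof_cat u v : prof (u ++ v) = prof u ++ prof v.
Proof. exact: map_cat. Qed.

Lemma size_prof w : size (prof w) = size w.
Proof. exact: size_map. Qed.

Lemma expo_cat u v c : expo (u ++ v) c = (expo u c + 2 ^ size u * expo v c)%N.
Proof.
elim: u => [|l u IHu] /=; first by rewrite mul1n.
by rewrite IHu doubleD addnA expnS -mulnA mul2n.
Qed.

Lemma alphaS i (b : bool) e : alpha i.+1 (b + e.*2) = alpha i e.
Proof. by rewrite /alpha expnS divnMA divn2 half_bit_double. Qed.

(** The summand with [q] stands for arbitrary digits above the word, such as a context or a carry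
    that leaves it. *)
Lemma alpha_expo i w c q :
  (i < size w)%N ->
  alpha i (expo w c + 2 ^ size w * q) = nth false (nth [::] w i) c.
Proof.
elim: w i => [//|l w IHw] [_|i lt_i] /=;
  rewrite expnS -mulnA mul2n -addnA -doubleD; last by rewrite alphaS IHw.
by rewrite /alpha divn1 oddD odd_double addbF oddb.
Qed.

Lemma expo_lt w c : (expo w c < 2 ^ size w)%N.
Proof.
elim: w => [//|l w IHw] /=; rewrite expnS mul2n; case: (nth _ _ _) => /=.
  by rewrite add1n ltn_Sdouble.
by rewrite ltn_double.
Qed.

Lemma degw_cons a w : degw (a :: w) = (a + (degw w).*2)%N.
Proof.
rewrite /degw /= big_ord_recl /= mul1n -mul2n big_distrr /=; congr (_ + _)%N.
by apply: eq_bigr => i _; rewrite /= expnS mulnA.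
Qed.

Lemma degw_cat u v : degw (u ++ v) = (degw u + 2 ^ size u * degw v)%N.
Proof.
elim: u => [|a u IHu] /=; first by rewrite mul1n /degw big_ord0.
by rewrite !degw_cons IHu doubleD addnA expnS -mulnA mul2n.
Qed.

Section Monomials.
Variable k : nat.
Implicit Types (u v w : word) (c : nat) (y : 'X_{1..k}).

Definition mon w : 'X_{1..k} := [multinom expo w j | j < k].

Lemma monE w (j : 'I_k) : mon w j = expo w j.
Proof. by rewrite mnmE. Qed.

Lemma count_nth (l : bitseq) : size l = k -> count id l = (\sum_(j < k) nth false l j)%N.
Proof.
move=> sz; rewrite -sumn_count sumnE big_map (big_nth false) sz big_mkord.
by apply: eq_bigr.
Qed.

Lemma omega_expo w (y : 'X_{1..k}) (q : 'I_k -> nat) i :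
  wf k w -> (forall j, y j = expo w j + 2 ^ size w * q j)%N -> (i < size w)%N ->
  omega y i = nth 0%N (prof w) i.
Proof.
move=> wfw yE lt_i; rewrite (nth_map [::]) // count_nth; last first.
  by apply/eqP/(allP wfw)/mem_nth.
by apply: eq_bigr => j _; rewrite yE alpha_expo.
Qed.

Lemma omega_mon w : wf k w -> omega (mon w) =1 wfun (prof w).
Proof.
move=> wfw i; case: (ltnP i (size w)) => [lt_i|le_i].
  by apply: (omega_expo (q := fun=> 0%N)) => // j; rewrite monE muln0 addn0.
rewrite /wfun nth_default ?size_prof // /omega big1 // => j _.
rewrite /alpha monE divn_small //; apply: leq_trans (expo_lt _ _) _.
by rewrite leq_exp2l.
Qed.

Lemma mdeg_mon w : wf k w -> mdeg (mon w) = degw (prof w).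
Proof.
rewrite mdegE; under eq_bigr do rewrite monE.
elim: w => [|l w IHw] /=; first by rewrite /degw big_ord0 big1.
case/andP=> /eqP szl /IHw; rewrite degw_cons -/(prof w) => <-; rewrite big_split /= count_nth //.
by rewrite -mul2n big_distrr /=; congr (_ + _)%N; apply: eq_bigr => j _; rewrite mul2n.
Qed.

Definition word_of n (y : 'X_{1..k}) : word :=
  mkseq (fun i => mkseq (fun j => odd (nth 0%N y j %/ 2 ^ i)) k) n.

Lemma wf_word_of n y : wf k (word_of n y).
Proof. by apply/allP=> l /mapP[i _ ->]; rewrite size_mkseq. Qed.

Lemma size_word_of n y : size (word_of n y) = n.
Proof. exact: size_mkseq. Qed.

Lemma expo_mkseq (e : nat -> nat) n c : (c < k)%N ->
  expo (mkseq (fun i => mkseq (fun j => odd (e j %/ 2 ^ i)) k) n) c = (e c %% 2 ^ n)%N.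
Proof.
move=> lt_c; elim: n e => [|n IHn] e; first by rewrite modn1.
rewrite /mkseq /= (iotaDl 1 0) -map_comp.
have -> : map ((fun i => mkseq (fun j => odd (e j %/ 2 ^ i)) k) \o addn 1) (iota 0 n)
    = mkseq (fun i => mkseq (fun j => odd ((e j)./2 %/ 2 ^ i)) k) n.
  apply: eq_map => i /=; apply: eq_map => j /=.
  by rewrite add1n expnS divnMA divn2.
rewrite (IHn (fun j => (e j)./2)) nth_mkseq // divn1.
rewrite -[in RHS](odd_double_half (e c)) [in RHS](divn_eq (e c)./2 (2 ^ n)).
rewrite doubleD addnCA -[((_ * 2 ^ n).*2)%N]mul2n mulnCA -expnS modnMDl [RHS]modn_small //.
have := ltn_pmod (e c)./2 (expn_gt0 2 n); rewrite expnS mul2n.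
by case: (odd _) => /= lt_m; rewrite ?add0n ?add1n ?ltn_Sdouble ?ltn_double.
Qed.

Lemma mon_word_of n y : (forall j, y j < 2 ^ n)%N -> mon (word_of n y) = y.
Proof.
move=> lt_y; apply/mnmP=> j; rewrite monE expo_mkseq //.
by rewrite modn_small -?(tnth_nth 0%N) ?lt_y.
Qed.

Lemma lt_omega n y : (forall i, (n <= i)%N -> omega y i = 0%N) ->
  forall j, (y j < 2 ^ n)%N.
Proof.
move=> om0 j; have [->|yj] := posnP (y j); first by rewrite expn_gt0.
rewrite ltnNge; apply/negP => le_n.
have lt_t := trunc_log_ltn (y j) (isT : 1 < 2)%N.
have le_t := trunc_logP (isT : 1 < 2)%N yj.
set t := trunc_log 2 (y j) in lt_t le_t.
have le_nt : (n <= t)%N by apply: trunc_log_max.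
have := om0 t le_nt; rewrite /omega (bigD1 j) //= /alpha.
have -> : (y j %/ 2 ^ t = 1)%N; last by [].
apply/eqP; rewrite eqn_leq leq_divRL ?expn_gt0 // mul1n le_t andbT.
by rewrite -ltnS ltn_divLR ?expn_gt0 // -expnS.
Qed.

End Monomials.

(** * Relations modulo hits and lower weights *)

(** Binary increment of one exponent. A carry out of the last letter is lost; [overflow] tells when
    this happens, and [expo_addc] restores the balance. *)
Fixpoint addc (c : nat) (w : word) : word :=
  if w is l :: w' then
    if nth false l c then set_nth false l c false :: addc c w'
    else set_nth false l c true :: w'
  else [::].

Definition overflow (c : nat) (w : word) := all (fun l : bitseq => nth false l c) w.

Lemma size_addc c w : size (addc c w) = size w.
Proof. by elim: w => //= l w IHw; case: ifP => _ //=; rewrite IHw. Qed.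

Lemma wf_addc k c w : (c < k)%N -> wf k w -> wf k (addc c w).
Proof.
move=> lt_c; elim: w => //= l w IHw /andP[/eqP szl wfw].
case: ifP => _ /=; rewrite size_set_nth szl (maxn_idPr lt_c) eqxx //=.
exact: IHw.
Qed.

Lemma expo_addc c w j :
  (expo (addc c w) j + (j == c) * overflow c w * 2 ^ size w = expo w j + (j == c))%N.
Proof.
elim: w => [|l w IHw] /=; first by rewrite !muln1.
case: ifP => bitc /=; rewrite nth_set_nth /=; last first.
  by rewrite muln0 mul0n addn0; case: eqP => [->|_]; rewrite ?addn0 // bitc; lia.
case: eqP IHw => [->|_] /=; last by lia.
rewrite bitc expnS; lia.
Qed.

(* A form of degw that evaluates: big operators are opaque. *)
Definition weight_degree (t : seq nat) : nat := foldr (fun a n => a + n.*2)%N 0%N t.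

Lemma degwE t : degw t = weight_degree t.
Proof. by elim: t => [|a t IHt]; [rewrite /degw big_ord0 | rewrite degw_cons IHt]. Qed.

Fixpoint lexlt (u v : seq nat) : bool :=
  match u, v with
  | a :: u', b :: v' => (a < b)%N || (a == b) && lexlt u' v'
  | _, _ => false
  end.

Lemma lexlt_nth u v : lexlt u v ->
  exists i, [/\ (i < size u)%N, (i < size v)%N,
    forall l, (l < i)%N -> nth 0%N u l = nth 0%N v l & (nth 0%N u i < nth 0%N v i)%N].
Proof.
elim: u v => [|a u IHu] [|b v] //= /orP[lt_ab|/andP[/eqP -> /IHu[i [iu iv eq_i lt_i]]]].
  by exists 0%N.
by exists i.+1; split=> // [[|l]] //=; apply: eq_i.
Qed.

Section Null.
Variable k : nat.
Implicit Types (p q : Pk k) (u v w h : word) (Z : seq word) (t : seq nat).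
Local Notation X w := ('X_[mon k w] : Pk k).

(** Unlike in [in_Wsub], the hit part need not lie in P_k(t), so single squares can be used freely;
    that membership is recovered at the end, in [dimQP_basis]. *)
Definition hit_mod_lower t p : Prop :=
  exists q r : Pk k, [/\ in_AplusP q, in_Pw_minus t r & p = q + r].

Lemma hml0 t : hit_mod_lower t 0.
Proof.
exists 0, 0; split; rewrite ?addr0 //; first exact: in_AplusP0.
by move=> y; rewrite msupp0.
Qed.

Lemma in_Pw_minusD t p q :
  in_Pw_minus t p -> in_Pw_minus t q -> in_Pw_minus t (p + q).
Proof. by move=> tp tq y /msuppD_le; rewrite mem_cat => /orP[/tp|/tq]. Qed.

Lemma hmlD t p q : hit_mod_lower t p -> hit_mod_lower t q -> hit_mod_lower t (p + q).
Proof.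
move=> [p1 [p2 [hp1 hp2 ->]]] [q1 [q2 [hq1 hq2 ->]]].
exists (p1 + q1), (p2 + q2); split; [exact: in_AplusPD | exact: in_Pw_minusD |].
by rewrite addrACA.
Qed.

Lemma hml_lower t p : in_Pw_minus t p -> hit_mod_lower t p.
Proof. by exists 0, p; split; rewrite ?add0r //; apply: in_AplusP0. Qed.

Lemma hml_hit t p : in_AplusP p -> hit_mod_lower t p.
Proof. by exists p, 0; split; rewrite ?addr0 // => y; rewrite msupp0. Qed.

(* A sum of words vanishes modulo hits and lower weights in every context of
   lower and higher binary digits. *)
Definition null t Z := forall u v, wf k u -> wf k v ->
  hit_mod_lower (prof u ++ t ++ prof v) (\sum_(z <- Z) X (u ++ z ++ v)).

Lemma null_nil t : null t [::].
Proof. by move=> u v _ _; rewrite big_nil; apply: hml0. Qed.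

Lemma null_cat t Z Z' : null t Z -> null t Z' -> null t (Z ++ Z').
Proof. by move=> nZ nZ' u v wu wv; rewrite big_cat; apply: hmlD; auto. Qed.

Lemma null_sum t Z Z' :
  (forall u v, \sum_(z <- Z) X (u ++ z ++ v) = \sum_(z <- Z') X (u ++ z ++ v)) ->
  null t Z -> null t Z'.
Proof. by move=> eqZ nZ u v wu wv; rewrite -eqZ; apply: nZ. Qed.

Lemma null_cons t l Z : size l = k ->
  null t Z -> null (count id l :: t) (map (cons l) Z).
Proof.
move=> szl nZ u v wu wv; rewrite big_map.
have := nZ (rcons u l) v; rewrite /wf all_rcons szl eqxx /= => /(_ wu wv).
rewrite /prof map_rcons cat_rcons.
by under eq_bigr do rewrite cat_rcons.
Qed.

Lemma null_rcat t v Z : wf k v -> null t Z -> null (t ++ prof v) (map (cat^~ v) Z).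
Proof.
move=> wv nZ u v' wu wv'; rewrite big_map.
rewrite -catA -prof_cat; under eq_bigr do rewrite -catA.
by apply: nZ; rewrite ?wf_cat ?wv.
Qed.

(* The terms of Sq^(2^r) of the monomial of h that add 2^r to a single exponent
   and are not of weight lower than t. *)
Definition hit_terms t (rh : nat * word) : seq word :=
  let: (r, h) := rh in
  [seq z <- [seq take r h ++ addc c (drop r h) |
               c <- iota 0 k & nth false (nth [::] h r) c] | ~~ lexlt (prof z) t].

(** Agreement with [t] below position r makes the weight drops of [Sq_pow2] drops below [t]. A carry
    that leaves [h] would alter the unknown digits above it, so it is tolerated only in terms that
    are already lower than [t]. *)
Definition hit_ok t (rh : nat * word) : bool :=
  let: (r, h) := rh in
  [&& (r < size h)%N, size h == size t, wf k h, take r (prof h) == take r t,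
      (weight_degree (prof h) + 2 ^ r == weight_degree t)%N &
      all (fun c => lexlt (prof (take r h ++ addc c (drop r h))) t
                    || ~~ overflow c (drop r h))
        [seq c <- iota 0 k | nth false (nth [::] h r) c]].

Lemma hit_null t rh : hit_ok t rh -> null t (hit_terms t rh).
Proof.
case: rh => r h /and5P[lt_r /eqP szh wfh /eqP taker /andP[/eqP degh /allP ovh]].
rewrite -!degwE in degh.
move=> u v wu wv.
set w := u ++ h ++ v; set R := (size u + r)%N; set T := prof u ++ t ++ prof v.
have wfw : wf k w by rewrite !wf_cat wu wfh wv.
have [low [SqE lowP]] := Sq_pow2 R (mon k w).
(* [G c] is given by exponents rather than by a word, because its carry may run through [h] into
   [v]. *)
pose G c : Pk k := 'X_[[multinom (expo w j + (val j == c) * 2 ^ R)%N | j < k]].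
pose cs := [seq c <- iota 0 k | nth false (nth [::] h r) c].
pose zc c := take r h ++ addc c (drop r h).
have degT : degw T = (mdeg (mon k w) + 2 ^ R)%N.
  rewrite mdeg_mon // /T /w !prof_cat !degw_cat -degh !size_prof szh expnD; lia.
have SqE' : Sq (2 ^ R) (X w) = \sum_(c <- cs) G c + low.
  rewrite SqE; congr (_ + _); rewrite /cs big_filter -[k in iota 0 k]subn0.
  rewrite -/(index_iota 0 k) big_mkord; apply: eq_big => [c|c _].
    have ltR : (R < size w)%N by rewrite /R /w !size_cat; lia.
    have -> : nth [::] h r = nth [::] w R.
      by rewrite /w nth_cat ltnNge leq_addr /= addKn nth_cat lt_r.
    have := alpha_expo c 0 ltR; rewrite monE muln0 addn0 /alpha.
    by case: (odd _); case: (nth _ _ _).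
  congr 'X_[_]; apply/mnmP=> j; rewrite mnmDE mulmnE mnm1E monE mnmE eq_sym.
  by rewrite -val_eqE.
have Gexpo c j : (expo w j + (j == c) * 2 ^ R =
    expo (u ++ zc c) j + 2 ^ size (u ++ zc c) *
      (expo v j + (j == c) * overflow c (drop r h)))%N.
  have := congr1 (muln (2 ^ size u * 2 ^ r)) (expo_addc c (drop r h) j).
  have szE : (2 ^ size h = 2 ^ r * 2 ^ size (drop r h))%N.
    by rewrite -expnD size_drop subnKC // ltnW.
  rewrite /w /zc -[h in expo (u ++ h ++ v)](cat_take_drop r h) !expo_cat !size_cat.
  rewrite size_addc size_takel ?(ltnW lt_r) // /R !expnD; lia.
have szuz c : size (u ++ zc c) = (size u + size t)%N.
  by rewrite size_cat /zc size_cat size_addc -size_cat cat_take_drop szh.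
have wfuz c : (c < k)%N -> wf k (u ++ zc c).
  move: wfh; rewrite wf_cat wu /zc -{1}(cat_take_drop r h) !wf_cat.
  by case/andP=> -> /wf_addc; apply.
have csP c : c \in cs -> (c < k)%N by rewrite mem_filter mem_iota => /andP[_].
have degG c y : c \in cs -> y \in msupp (G c) -> mdeg y = degw T.
  move=> /csP lt_c; rewrite msuppX inE => /eqP ->; rewrite degT !mdegE.
  under eq_bigr do rewrite mnmE; rewrite big_split /=; congr (_ + _)%N.
    by apply: eq_bigr => j _; rewrite monE.
  rewrite (bigD1 (Ordinal lt_c)) //= eqxx mul1n big1 ?addn0 // => j.
  by rewrite -val_eqE /= => /negPf ->.
(* A drop inside the span of [t] decides the comparison, whatever a carry does to the digits of
   [v]. *)
have droppedP c : c \in cs -> lexlt (prof (zc c)) t -> in_Pw_minus T (G c).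
  move=> c_cs /lexlt_nth[i [_ lt_it eq_i lt_i]] y yG; split; first exact: degG yG.
  have om l : (l < size u + size t)%N -> omega y l = nth 0%N (prof u ++ prof (zc c)) l.
    move=> lt_l; rewrite -prof_cat.
    apply: (omega_expo (q := fun j => (expo v j + (val j == c) * overflow c (drop r h))%N)).
    - exact/wfuz/csP.
    - by move: yG; rewrite msuppX inE => /eqP -> j; rewrite mnmE Gexpo.
    - by rewrite szuz.
  exists (size u + i)%N; split=> [l lt_l|].
    rewrite om ?(leq_trans lt_l) ?leq_add2l ?(ltnW lt_it) // /wfun /T !nth_cat size_prof.
    by case: ltnP => // le_ul; rewrite eq_i ?ifT //; lia.
  rewrite om ?ltn_add2l // /wfun /T !nth_cat size_prof addKn lt_it.
  by have -> : (size u + i < size u)%N = false by lia.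
(* Below position R the weight of [w] agrees with [T], so a drop there relative to [w] is one
   relative to [T]. *)
have lowT : in_Pw_minus T low.
  move=> y /lowP[degy [l [lt_lR eq_l lt_l]]]; split; first by rewrite degy degT.
  have omT i : (i < R)%N -> omega (mon k w) i = wfun T i.
    move=> lt_i; rewrite omega_mon // /wfun /w /T !prof_cat !nth_cat size_prof.
    case: ltnP => // le_ui; have lt_ir : (i - size u < r)%N by rewrite /R in lt_i; lia.
    rewrite size_prof szh (leq_trans lt_ir) -?szh ?(ltnW lt_r) //.
    by rewrite -(nth_take _ lt_ir) taker nth_take // ?leq_trans.
  exists l; split=> [i lt_il|]; last by rewrite -omT.
  by rewrite eq_l // omT // (ltn_trans lt_il).
have keptE : \sum_(z <- hit_terms t (r, h)) X (u ++ z ++ v) =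
    \sum_(c <- cs | ~~ lexlt (prof (zc c)) t) G c.
  rewrite /hit_terms big_filter big_map -/cs big_seq_cond [RHS]big_seq_cond.
  apply: eq_bigr => c /andP[c_cs nlt]; have := ovh c c_cs; rewrite (negPf nlt) /= => nov.
  congr 'X_[_]; apply/mnmP=> j; rewrite monE mnmE Gexpo (negPf nov) muln0 addn0.
  by rewrite catA expo_cat.
have dropped : in_Pw_minus T (\sum_(c <- cs | lexlt (prof (zc c)) t) G c).
  rewrite big_seq_cond; elim/big_ind: _ => [y|p q|c /andP[c_cs lt_c]]; rewrite ?msupp0 //.
    exact: in_Pw_minusD.
  exact: droppedP.
rewrite keptE; have := SqE'; rewrite (bigID (fun c => lexlt (prof (zc c)) t)) /=.
set D := \sum_(c <- cs | lexlt _ _) _; set K := \sum_(c <- cs | ~~ lexlt _ _) _ => SqE2.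
have -> : K = Sq (2 ^ R) (X w) + (D + low).
  by rewrite SqE2 addrACA addpp addr0 [D + K]addrC -addrA addpp addr0.
apply: hmlD; first by apply/hml_hit/in_AplusP_Sq; rewrite expn_gt0.
by apply/hml_lower/in_Pw_minusD.
Qed.

End Null.

(** * Rewriting of words *)

(** Compares exponents without computing them: the last letter is the most significant digit, so the
    recursive call decides first. *)
Fixpoint column_cmp (c : nat) (u v : word) : comparison :=
  match u, v with
  | l :: u', m :: v' =>
    if column_cmp c u' v' is Eq then
      match nth false l c, nth false m c with
      | true, false => Gt
      | false, true => Lt
      | _, _ => Eq
      end
    else column_cmp c u' v'
  | _, _ => Eq
  end.

Fixpoint word_cmp_from (n c : nat) (u v : word) : comparison :=
  if n is n'.+1 then
    match column_cmp c u v with Eq => word_cmp_from n' c.+1 u v | r => r end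
  else Eq.

Definition word_cmp (k : nat) := word_cmp_from k 0.

Lemma column_cmpP c u v : size u = size v ->
  match column_cmp c u v with
  | Lt => (expo u c < expo v c)%N
  | Eq => expo u c = expo v c
  | Gt => (expo v c < expo u c)%N
  end.
Proof.
elim: u v => [|l u IHu] [|m v] //= [/IHu].
by case: (column_cmp c u v); case: (nth false l c); case: (nth false m c) => /=; lia.
Qed.

(** Only words of equal profile are compared, and on these the order of monomials reduces to
    sigma. *)
Definition word_lt (k : nat) (u v : word) := ltlex (sigma (mon k u)) (sigma (mon k v)).

Lemma sigma_mon k w j : sigma (mon k w) j = if (j < k)%N then expo w j else 0%N.
Proof.
rewrite /sigma; case: ltnP => [lt_j|le_j].
  by rewrite -(mnm_nth 0%N (mon k w) (Ordinal lt_j)) monE.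
by rewrite nth_default // size_tuple.
Qed.

Lemma word_ltP k u v :
  word_lt k u v <-> exists j, [/\ (j < k)%N, forall l, (l < j)%N -> expo u l = expo v l
                              & (expo u j < expo v j)%N].
Proof.
split=> [[j [eq_l]]|[j [lt_jk eq_l lt_j]]].
  rewrite !sigma_mon; case: (ltnP j k) => // lt_jk lt_j; exists j; split=> // l lt_l.
  by have := eq_l l lt_l; rewrite !sigma_mon (ltn_trans lt_l lt_jk).
exists j; split=> [l lt_l|]; rewrite !sigma_mon ?lt_jk //.
by rewrite (ltn_trans lt_l lt_jk) eq_l.
Qed.

Lemma word_cmp_lt k u v : size u = size v -> word_cmp k u v = Lt -> word_lt k u v.
Proof.
move=> szuv cmp_uv; apply/word_ltP.
have main n c : (n + c = k)%N -> (forall l, (l < c)%N -> expo u l = expo v l) ->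
    word_cmp_from n c u v = Lt ->
    exists j, [/\ (j < k)%N, forall l, (l < j)%N -> expo u l = expo v l
               & (expo u j < expo v j)%N].
  elim: n c => [//|n IHn] c nck eq_lt /=; have := column_cmpP c szuv.
  case: (column_cmp c u v) => // [eq_c|lt_c _]; last by exists c; split=> //; lia.
  apply: IHn => [|l]; first by rewrite addnS.
  by rewrite ltnS leq_eqVlt => /orP[/eqP -> //|/eq_lt].
by apply: (main k 0%N); rewrite ?addn0.
Qed.

Lemma word_lt_ctx k x y u v : size u = size v ->
  word_lt k u v -> word_lt k (x ++ u ++ y) (x ++ v ++ y).
Proof.
move=> szuv /word_ltP[j [lt_jk eq_l lt_j]]; apply/word_ltP; exists j; split=> // [l lt_l|].
  by rewrite !expo_cat szuv eq_l.
by rewrite !expo_cat szuv ltn_add2l ltn_pmul2l ?expn_gt0 // ltn_add2r.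
Qed.

(* Evaluates much faster than the generic [==]. *)
Fixpoint letter_eqb (l m : bitseq) : bool :=
  match l, m with
  | [::], [::] => true
  | a :: l', b :: m' => (if a then b else ~~ b) && letter_eqb l' m'
  | _, _ => false
  end.

Fixpoint word_eqb (u v : word) : bool :=
  match u, v with
  | [::], [::] => true
  | l :: u', m :: v' => letter_eqb l m && word_eqb u' v'
  | _, _ => false
  end.

Lemma word_eqbP u v : word_eqb u v -> u = v.
Proof.
have letterP l m : letter_eqb l m -> l = m.
  by elim: l m => [|a l IHl] [|b m] //= /andP[ab /IHl ->]; case: a b ab => [] [].
by elim: u v => [|l u IHu] [|m v] //= /andP[/letterP -> /IHu ->].
Qed.

Section Merge.
Variable k : nat.

(** Addition over F_2 of sums kept in decreasing order, equal words cancelling. The sum is preserved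
    for unsorted lists as well, so no sortedness invariant has to be carried. *)
Fixpoint xor_merge (u : seq word) : seq word -> seq word :=
  fix merge_u (v : seq word) : seq word :=
  match u, v with
  | [::], _ => v
  | _, [::] => u
  | a :: u', b :: v' =>
    match word_cmp k a b with
    | Gt => a :: xor_merge u' v
    | Lt => b :: merge_u v'
    | Eq => if word_eqb a b then xor_merge u' v' else a :: b :: xor_merge u' v'
    end
  end.

Definition xor_sort (u : seq word) : seq word :=
  foldr (fun w => xor_merge [:: w]) [::] u.

Lemma sum_xor_merge (V : zmodType) (F : word -> V) u v :
  (forall x : V, x + x = 0) ->
  \sum_(w <- xor_merge u v) F w = \sum_(w <- u) F w + \sum_(w <- v) F w.
Proof.
move=> char2; elim: u v => [|a u IHu]; first by case=> [|b v]; rewrite /= big_nil add0r.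
elim=> [|b v IHv]; first by rewrite big_nil addr0.
have -> : xor_merge (a :: u) (b :: v) = match word_cmp k a b with
    | Gt => a :: xor_merge u (b :: v)
    | Lt => b :: xor_merge (a :: u) v
    | Eq => if word_eqb a b then xor_merge u v else a :: b :: xor_merge u v
    end by [].
case: (word_cmp k a b); last by rewrite !big_cons IHu big_cons addrA.
  case: ifP => [/word_eqbP <-|_]; rewrite !big_cons IHu [RHS]addrACA.
    by rewrite char2 add0r.
  exact: addrA.
by rewrite big_cons IHv !big_cons addrCA.
Qed.

Lemma mem_xor_merge u v : {subset xor_merge u v <= u ++ v}.
Proof.
elim: u v => [|a u IHu]; first by case=> [|b v] x.
elim=> [|b v IHv] x; first by rewrite cats0.
have -> : xor_merge (a :: u) (b :: v) = match word_cmp k a b with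
    | Gt => a :: xor_merge u (b :: v)
    | Lt => b :: xor_merge (a :: u) v
    | Eq => if word_eqb a b then xor_merge u v else a :: b :: xor_merge u v
    end by [].
have sub w : w \in xor_merge u v -> w \in (a :: u) ++ b :: v.
  by move/IHu; rewrite !mem_cat !inE => /orP[]->; rewrite !orbT.
have memb : b \in (a :: u) ++ b :: v by rewrite mem_cat !inE eqxx orbT.
have mema : a \in (a :: u) ++ b :: v by rewrite mem_cat !inE eqxx.
case: (word_cmp k a b); first case: ifP => _; first exact: sub.
- by rewrite !inE => /or3P[/eqP ->|/eqP ->|/sub].
- rewrite inE => /orP[/eqP -> //|/IHv]; rewrite !mem_cat [x \in b :: v]inE.
  by case/orP=> ->; rewrite ?orbT.
- rewrite inE => /orP[/eqP -> //|/IHu]; rewrite !mem_cat [x \in a :: u]inE.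
  by case/orP=> ->; rewrite ?orbT.
Qed.

Lemma sum_xor_sort (V : zmodType) (F : word -> V) u :
  (forall x : V, x + x = 0) -> \sum_(w <- xor_sort u) F w = \sum_(w <- u) F w.
Proof.
move=> char2; elim: u => [//|w u IHu].
by rewrite -[xor_sort _]/(xor_merge [:: w] (xor_sort u)) sum_xor_merge // IHu big_seq1 big_cons.
Qed.

End Merge.

(* A rule (w, R) rewrites w to the sum of R; a trie indexes the rules by the bits
   of w. *)
Definition rule : Type := word * seq word.

Inductive trie := Leaf | Node of option rule & trie & trie.

Fixpoint walk_letter (l : bitseq) (T : trie) : trie :=
  match l, T with
  | b :: l', Node _ T0 T1 => walk_letter l' (if b then T1 else T0)
  | _, _ => T
  end.

Fixpoint walk (w : word) (T : trie) : option (rule * word) :=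
  match T with
  | Leaf => None
  | Node (Some e) _ _ => Some (e, w)
  | Node None _ _ => if w is l :: w' then walk w' (walk_letter l T) else None
  end.

Fixpoint insert (l : bitseq) (e : rule) (T : trie) : trie :=
  let: (o, T0, T1) := if T is Node o T0 T1 then (o, T0, T1) else (None, Leaf, Leaf) in
  match l with
  | [::] => Node (Some e) T0 T1
  | b :: l' => if b then Node o T0 (insert l' e T1) else Node o (insert l' e T0) T1
  end.

Fixpoint trie_all (P : rule -> Prop) (T : trie) : Prop :=
  if T is Node o T0 T1 then
    [/\ (if o is Some e then P e else True), trie_all P T0 & trie_all P T1]
  else True.

Lemma trie_all_insert P l e T : P e -> trie_all P T -> trie_all P (insert l e T).
Proof.
move=> Pe; elim: l T => [|b l IHl] [|o T0 T1] //=; first by case.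
  by case: b => _; split=> //; apply: IHl.
by case: b => -[? ? ?]; split=> //; apply: IHl.
Qed.

Lemma trie_all_walk P w T e v : trie_all P T -> walk w T = Some (e, v) -> P e.
Proof.
have walkP l U : trie_all P U -> trie_all P (walk_letter l U).
  by elim: l U => [|b l IHl] [|o U0 U1] //= [_ ? ?]; apply: IHl; case: b.
elim: w T => [|l w IHw] [|[e'|] T0 T1] //=.
- by case=> Pe _ _ [<- _].
- by case=> Pe _ _ [<- _].
move=> PT; apply: IHw; case: l => [|b l] //=; apply: walkP.
by case: b; case: PT.
Qed.

Arguments walk : simpl never.
Arguments xor_merge : simpl never.

(** The match found by the trie is checked against [w] itself, so soundness does not depend on how
    the rules are indexed. *)
Fixpoint reduct (T : trie) (w : word) : option (seq word) :=
  match walk w T with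
  | Some (e, v) => if word_eqb (e.1 ++ v) w then Some (map (cat^~ v) e.2) else None
  | None => if w is l :: w' then omap (map (cons l)) (reduct T w') else None
  end.

Fixpoint normalize (k fuel : nat) (T : trie) (Z : seq word) : seq word :=
  if fuel is n.+1 then
    if Z is w :: Z' then
      if reduct T w is Some R then normalize k n T (xor_merge k R Z')
      else w :: normalize k n T Z'
    else [::]
  else Z.

Definition has_prof (k : nat) (t : seq nat) (w : word) := wf k w && (prof w == t).

(** Solving the relation for its head requires only that all other words be smaller, which is tested
    here. Hence neither the order of the lists nor exhaustion of the fuel 5000 can affect
    soundness. *)
Definition add_rule (k : nat) (T : trie) (t : seq nat) (item : seq (nat * word)) :
    option trie :=
  let Z := xor_sort k (flatten (map (hit_terms k t) item)) in
  if all (hit_ok k t) item && all (has_prof k t) Z then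
    if normalize k 5000 T Z is w :: R then
      if all (fun z => if word_cmp k z w is Lt then true else false) R
      then Some (insert (flatten w) (w, R) T) else None
    else None
  else None.

Fixpoint build (k : nat) (T : trie) (items : seq (seq nat * seq (nat * word))) :
    option trie :=
  if items is (t, item) :: items' then
    if add_rule k T t item is Some T' then build k T' items' else None
  else Some T.

Section Sound.
Variable k : nat.

Definition rewrites (w : word) (Z : seq word) : Prop :=
  [/\ wf k w, all (has_prof k (prof w)) Z, null k (prof w) (w :: Z)
    & forall z, z \in Z -> word_lt k z w].

Lemma has_prof_size t z w : has_prof k t z -> t = prof w -> size z = size w.
Proof. by case/andP=> _ /eqP zt tw; rewrite -size_prof zt tw size_prof. Qed.

Lemma rewrites_cons l w Z : size l = k ->
  rewrites w Z -> rewrites (l :: w) (map (cons l) Z).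
Proof.
move=> szl [wfw profZ nZ ltZ]; split.
- by rewrite /= szl eqxx.
- rewrite all_map; apply: sub_all profZ => z /andP[wfz /eqP profz].
  by rewrite /has_prof /= szl eqxx wfz profz eqxx.
- exact: (null_cons szl nZ).
move=> z' /mapP[z zZ ->]; have := allP profZ z zZ => /has_prof_size /(_ erefl) szz.
by have := word_lt_ctx [:: l] [::] szz (ltZ z zZ); rewrite /= !cats0.
Qed.

Lemma rewrites_cat w v Z : wf k v ->
  rewrites w Z -> rewrites (w ++ v) (map (cat^~ v) Z).
Proof.
move=> wfv [wfw profZ nZ ltZ]; split.
- by rewrite wf_cat wfw.
- rewrite all_map; apply: sub_all profZ => z /andP[wfz /eqP profz].
  by rewrite /has_prof /= wf_cat wfz wfv !prof_cat profz eqxx.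
- by rewrite prof_cat; apply: (null_rcat wfv nZ).
move=> z' /mapP[z zZ ->]; have := allP profZ z zZ => /has_prof_size /(_ erefl) szz.
exact: (word_lt_ctx [::] v szz (ltZ z zZ)).
Qed.

Definition valid_rule (e : rule) := rewrites e.1 e.2.

Lemma reductP T w R : trie_all valid_rule T -> wf k w ->
  reduct T w = Some R -> rewrites w R.
Proof.
have walkP x e v : wf k x -> walk x T = Some (e, v) -> word_eqb (e.1 ++ v) x ->
    trie_all valid_rule T -> rewrites x (map (cat^~ v) e.2).
  move=> wfx E /word_eqbP xE PT; have Pe := trie_all_walk PT E.
  rewrite -xE; apply: rewrites_cat => //.
  by move: wfx; rewrite -xE wf_cat => /andP[].
move=> PT; elim: w R => [|l w IHw] R wfw /=.
  case E: (walk _ _) => [[e v]|//]; case: ifP => // wE [<-].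
  exact: walkP E wE PT.
case E: (walk _ _) => [[e v]|].
  case: ifP => // wE [<-]; exact: walkP E wE PT.
case/andP: wfw => /eqP szl wfw; case E': (reduct T w) => [R'|//] [<-].
exact: rewrites_cons szl (IHw _ wfw E').
Qed.

Lemma normalizeP n T t Z : trie_all valid_rule T ->
  all (has_prof k t) Z -> null k t Z ->
  all (has_prof k t) (normalize k n T Z) /\ null k t (normalize k n T Z).
Proof.
(* [Y] collects the irreducible words already emitted; only the whole sum is null, not the part
   still to be processed. *)
move=> PT; suff main (Y : seq word) : all (has_prof k t) Z -> null k t (Y ++ Z) ->
    all (has_prof k t) (normalize k n T Z) /\ null k t (Y ++ normalize k n T Z).
  exact: main [::].
elim: n Y Z => [//|n IHn] Y [|w Z] //= /andP[/andP[wfw /eqP profw] profZ] nZ.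
case E: (reduct T w) => [R|]; last first.
  have := IHn (rcons Y w) Z profZ; rewrite !cat_rcons => /(_ nZ) [? ?].
  by rewrite /= /has_prof wfw profw eqxx.
have [_ profR nR _] := reductP PT wfw E; rewrite profw in profR nR.
apply: IHn => [|u v wu wv].
  apply/allP=> z /mem_xor_merge; rewrite mem_cat => /orP[/(allP profR)|/(allP profZ)] //.
have := hmlD (nZ u v wu wv) (nR u v wu wv).
rewrite !big_cat !big_cons sum_xor_merge; last exact: addpp.
set a := \sum_(z <- Y) _; set b := \sum_(z <- Z) _; set c := \sum_(z <- R) _.
set x := 'X_[_]; suff -> : a + (x + b) + (x + c) = a + (c + b) by [].
by rewrite -addrA addrACA addpp add0r [c + b]addrC.
Qed.

Lemma add_ruleP T t item T' : trie_all valid_rule T ->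
  add_rule k T t item = Some T' -> trie_all valid_rule T'.
Proof.
move=> PT; rewrite /add_rule; case: ifP => // /andP[okI profZ].
set Z := xor_sort _ _ in profZ *.
have nZ : null k t Z.
  apply: (@null_sum _ _ (flatten (map (hit_terms k t) item))).
    by move=> u v; rewrite sum_xor_sort //; apply: addpp.
  elim: item okI {profZ Z} => [_|rh item IHi /= /andP[okrh /IHi nI]]; first exact: null_nil.
  exact: null_cat (hit_null okrh) nI.
have := normalizeP 5000 PT profZ nZ.
case: (normalize _ _ _ _) => // w R [/andP[/andP[wfw /eqP profw] profR] nR].
case: ifP => // /allP ltR [<-]; apply: trie_all_insert => //.
split; rewrite /= ?profw //= => z zR.
apply: word_cmp_lt; last by have := ltR z zR; case: (word_cmp k z w).
exact: has_prof_size (allP profR z zR) (esym profw).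
Qed.

Lemma buildP T items T' : trie_all valid_rule T ->
  build k T items = Some T' -> trie_all valid_rule T'.
Proof.
elim: items T => [|[t item] items IHi] T PT /=; first by case=> <-.
by case E: (add_rule k T t item) => [U|//]; apply: IHi (add_ruleP PT E).
Qed.

End Sound.

(** * Functionals vanishing on hit polynomials *)

Section TotalSquare.
Variable k : nat.
Implicit Types (p q : Pk k) (a b m y : 'X_{1..k}).

(** The total Steenrod square, the sum of all Sq^i. As a ring endomorphism it can be commuted with
    substitutions, which is awkward for a single Sq^i. *)
Definition total_Sq p : Pk k := p \mPo [tuple 'X_j + 'X_j ^+ 2 | j < k].

Lemma mcoeff_total_Sq a y :
  (total_Sq 'X_[a])@_y = ((a <= y)%MM && odd (\prod_(j < k) 'C(a j, (y - a)%MM j)))%:R.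
Proof.
rewrite /total_Sq comp_mpolyX.
(* A common range for all binomial expansions, so that their product distributes into a sum over
   functions from the variables to ['I_N]. *)
pose N := (mdeg a).+1.
have aN j : (a j < N)%N by rewrite ltnS mdegE (bigD1 j) //= leq_addr.
have powE j : (tnth [tuple 'X_j + 'X_j ^+ 2 | j < k] j : Pk k) ^+ a j =
    \sum_(i < N) ('C(a j, i))%:R *: 'X_[U_(j) *+ (a j + i)].
  rewrite tnth_mktuple exprDn.
  rewrite (big_ord_widen N (fun i => 'X_j ^+ (a j - i) * ('X_j ^+ 2) ^+ i *+ 'C(a j, i)));
    last exact: aN.
  rewrite [RHS](bigID (fun i : 'I_N => (i < (a j).+1)%N)) /= [X in _ + X]big1 ?addr0.
    apply: eq_bigr => i lt_i; rewrite -exprM -exprD scaler_nat; congr (_ *+ _).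
    by rewrite -mpolyXn; congr ('X_j ^+ _); lia.
  by move=> i; rewrite -leqNgt => le_i; rewrite bin_small // scale0r.
rewrite (eq_bigr _ (fun j _ => powE j)) bigA_distr_bigA /= raddf_sum /=.
have termE (f : {ffun 'I_k -> 'I_N}) :
    \prod_(j < k) (('C(a j, f j))%:R *: 'X_[U_(j) *+ (a j + f j)]) =
    ((\prod_(j < k) 'C(a j, f j))%N)%:R *: 'X_[[multinom (a j + f j)%N | j < k]] :> Pk k.
  rewrite scaler_prod natr_prod; congr (_ *: _).
  rewrite [RHS]mpolyXE_id; apply: eq_bigr => j _.
  by rewrite -mpolyXn mnmE.
under eq_bigr => f _ do rewrite termE mcoeffZ mcoeffX.
case: (boolP (a <= y)%MM) => [le_ay|nle] /=; last first.
  apply: big1 => f _; case: eqP => [yE|_]; last by rewrite mulr0.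
  by case/mnm_lepP: nle => j; rewrite -yE mnmE leq_addr.
case: (boolP [forall j, (y - a)%MM j < N]%N) => [/forallP lt_N|].
  pose f0 := [ffun j => Ordinal (lt_N j)].
  rewrite (bigD1 f0) //= [X in _ + X]big1 ?addr0.
    have -> : [multinom (a j + f0 j)%N | j < k] = y.
      by apply/mnmP=> j; rewrite mnmE ffunE /= mnmBE subnKC //; apply/mnm_lepP.
    rewrite eqxx mulr1 [LHS]natrF2; congr ((nat_of_bool (odd _))%:R).
    by apply: eq_bigr => j _; rewrite ffunE.
  move=> f ne_f; case: eqP => [yE|_]; last by rewrite mulr0.
  case/eqP: ne_f; apply/ffunP=> j; apply/val_inj; rewrite ffunE /= mnmBE -yE mnmE.
  by rewrite addKn.
rewrite negb_forall => /existsP[j]; rewrite -leqNgt => le_N.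
rewrite [odd _](_ : _ = false) /=; last first.
  by rewrite (bigD1 j) //= bin_small ?mul0n // (leq_trans (aN j)).
apply: big1 => f _; case: eqP => [yE|_]; last by rewrite mulr0.
by move: le_N; rewrite mnmBE -yE mnmE addKn leqNgt ltn_ord.
Qed.

Lemma mcoeff_part p (P : pred 'X_{1..k}) y :
  (\sum_(m <- msupp p | P m) 'X_[m] : Pk k)@_y = (P y)%:R * p@_y.
Proof.
rewrite raddf_sum /= -big_filter; under eq_bigr do rewrite mcoeffX.
case: (boolP (y \in [seq m <- msupp p | P m])) => [y_in|y_out].
  rewrite (bigD1_seq y) ?filter_uniq ?msupp_uniq //= eqxx big1 ?addr0 => [|m /negPf -> //].
  move: y_in; rewrite mem_filter mcoeff_msupp => /andP[-> /F2_neq0 ->].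
  by rewrite mulr1.
rewrite big_seq big1 => [|m m_in].
  move: y_out; rewrite mem_filter mcoeff_msupp negb_and negbK.
  by case/orP => [/negPf ->|/eqP ->]; rewrite ?mul0r ?mulr0.
by case: eqP => // mE; move: y_out; rewrite -mE m_in.
Qed.

Lemma Sq_mon_part i a :
  Sq_mon i a = \sum_(y <- msupp (total_Sq 'X_[a]) | mdeg y == (mdeg a + i)%N) 'X_[y].
Proof.
apply/mpolyP => y; rewrite mcoeff_Sq_mon mcoeff_part mcoeff_total_Sq -natrM mulnb.
case: (boolP (a <= y)%MM) => [le_ay|] /=; last by rewrite andbF.
suff -> : (mdeg (y - a)%MM == i) = (mdeg y == mdeg a + i)%N by [].
by rewrite -[in RHS](submK le_ay) mdegD addnC eqn_add2l.
Qed.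

Definition is_spike (e : 'X_{1..k}) := forall j, exists n, e j = (2 ^ n).-1.

(** If b = 2^n - 1 - a is nonzero with lowest digit 1 at t, Lucas puts a digit 1 of [a] at t; then a
    + b has digit 0 there, although all digits of 2^n - 1 below n are 1. *)
Lemma odd_bin_spike (n a : nat) : (a <= (2 ^ n).-1)%N ->
  odd 'C(a, (2 ^ n).-1 - a) -> a = (2 ^ n).-1.
Proof.
move=> le_a; set b := (_ - a)%N; have [b0|b_gt0] := posnP b; first by move=> _; lia.
have [t bE odd_q] : exists2 t, b = (2 ^ t * (b %/ 2 ^ t))%N & odd (b %/ 2 ^ t).
  exists (logn 2 b); first by rewrite mulnC divnK // pfactor_dvdnn.
  have [m + bE] := pfactor_coprime (isT : prime 2) b_gt0.
  by rewrite {1}bE mulnK ?expn_gt0 // prime_coprime // dvdn2 negbK.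
rewrite bE => /(odd_bin_bit odd_q) bit_a.
have lt_tn : (t < n)%N.
  rewrite -(ltn_exp2l _ _ (isT : 1 < 2)%N); apply: leq_ltn_trans (_ : b < 2 ^ n)%N.
    by rewrite [leqRHS]bE leq_pmulr // lt0n; apply: contraTneq odd_q => ->.
  by rewrite -(prednK (expn_gt0 2 n)) ltnS leq_subr.
have := alpha_add_at t (b %/ 2 ^ t) a; rewrite -bE bit_a odd_q subnKC // /alpha.
have -> : ((2 ^ n).-1 %/ 2 ^ t = (2 ^ (n - t)).-1)%N.
  rewrite -{1}(subnK (ltnW lt_tn)) expnD.
  have := expn_gt0 2 (n - t); case: (2 ^ (n - t))%N => // m _.
  rewrite mulSn -subn1 -addnBAC ?expn_gt0 // addnC divnMDl ?expn_gt0 //.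
  by rewrite divn_small ?addn0 // -{2}(prednK (expn_gt0 2 t)) subn1.
by rewrite -subn1 oddB ?expn_gt0 // oddX subn_eq0 leqNgt lt_tn.
Qed.

Lemma mcoeff_total_Sq_spike e q : is_spike e -> (total_Sq q)@_e = q@_e.
Proof.
move=> spike_e; rewrite [q in RHS]mpolyE /total_Sq comp_mpolyEX !raddf_sum /=.
apply: eq_bigr => m _; rewrite !mcoeffZ; congr (_ * _).
rewrite -/(total_Sq _) mcoeff_total_Sq mcoeffX.
case: eqP => [->|ne_me].
  rewrite lepm_refl big1 // => j _; by rewrite mnmBE subnn bin0.
case: (boolP (m <= e)%MM) => //= /mnm_lepP le_me.
case: (boolP (odd _)) => // odd_C; case: ne_me; apply/mnmP => j.
have [n eE] := spike_e j; have := le_me j; rewrite eE => /odd_bin_spike; apply.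
have := odd_prod (F := fun j => 'C(m j, (e - m)%MM j)) j odd_C.
by rewrite mnmBE eE.
Qed.

End TotalSquare.

Section Substitution.
Variables (k n : nat) (cols : seq bitseq).
Implicit Types (p q : Pk k) (a m y : 'X_{1..k}) (col l : bitseq).

Definition linear_form col : Pk n := \sum_(i < n | nth false col i) 'X_i.

Definition subst p : Pk n := p \mPo [tuple linear_form (nth [::] cols c) | c < k].

Lemma sqrDp (q q' : Pk n) : (q + q') ^+ 2 = q ^+ 2 + q' ^+ 2.
Proof. by rewrite sqrrD mulr2n addpp addr0. Qed.

Lemma sqr_sum (I : Type) (r : seq I) (P : pred I) (F : I -> Pk n) :
  (\sum_(i <- r | P i) F i) ^+ 2 = \sum_(i <- r | P i) F i ^+ 2.
Proof.
by elim/big_rec2: _ => [|i q q' _ <-]; [rewrite expr0n | rewrite sqrDp].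
Qed.

Lemma total_Sq_linear_form col :
  total_Sq (linear_form col) = linear_form col + linear_form col ^+ 2.
Proof.
rewrite /linear_form sqr_sum -big_split /total_Sq [LHS](raddf_sum (comp_mpoly _)) /=.
by apply: eq_bigr => i _; rewrite comp_mpolyXU -tnth_nth tnth_mktuple.
Qed.

(** Both sides are ring homomorphisms in [p]; on a variable they agree because squaring is additive
    in characteristic 2. *)
Lemma subst_total_Sq p : subst (total_Sq p) = total_Sq (subst p).
Proof.
rewrite [total_Sq p in LHS]comp_mpolyEX [subst p in RHS]comp_mpolyEX /subst /total_Sq.
rewrite !(raddf_sum (comp_mpoly _)) /=; apply: eq_bigr => m _.
rewrite !linearZ /=; congr (_ *: _); rewrite !comp_mpolyX !rmorph_prod.
apply: eq_bigr => c _; rewrite !rmorphXn /= !tnth_mktuple; congr (_ ^+ _).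
rewrite rmorphD rmorphXn /= comp_mpolyXU -tnth_nth tnth_mktuple.
by rewrite -/(total_Sq _) total_Sq_linear_form.
Qed.

Lemma linear_form_homog col : linear_form col \is 1.-homog for mdeg.
Proof. by apply: rpred_sum => i _; rewrite dhomogX; apply/eqP/mdeg1. Qed.

Lemma prod_homog (I : finType) (P : pred I) (d : I -> nat) (F : I -> Pk n) :
  (forall i, P i -> F i \is (d i).-homog for mdeg) ->
  \prod_(i | P i) F i \is (\sum_(i | P i) d i)%N.-homog for mdeg.
Proof.
move=> homF; elim/big_rec2: _ => [|i e q Pi hom]; first exact: dhomog1.
exact: dhomogM (homF i Pi) hom.
Qed.

Lemma subst_homog m : subst 'X_[m] \is (mdeg m).-homog for mdeg.
Proof.
rewrite /subst comp_mpolyX mdegE; apply: prod_homog => c _.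
rewrite tnth_mktuple; have := dhomogMn (m c) (linear_form_homog (nth [::] cols c)).
by rewrite mul1n.
Qed.

Lemma mcoeff_subst_deg m (e : 'X_{1..n}) : mdeg m != mdeg e -> (subst 'X_[m])@_e = 0.
Proof. by rewrite eq_sym; apply: dhomog_nemf_coeff (subst_homog m). Qed.

Lemma subst_sum (I : Type) (r : seq I) (P : pred I) (F : I -> Pk k) :
  subst (\sum_(i <- r | P i) F i) = \sum_(i <- r | P i) subst (F i).
Proof. exact: (raddf_sum (comp_mpoly _)). Qed.

(** Substitution preserves degree, so in the degree of [e] the square may be replaced by the total
    square. This moves past the substitution and is invisible to the spike [e], leaving the
    coefficient of a form of degree smaller by i. *)
Lemma mcoeff_subst_Sq_mon i a (e : 'X_{1..n}) :
  is_spike e -> (0 < i)%N -> (subst (Sq_mon i a))@_e = 0.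
Proof.
move=> spike_e i_gt0; rewrite Sq_mon_part subst_sum raddf_sum /=.
case: (boolP (mdeg a + i == mdeg e)%N) => [/eqP deg_e|ne_e]; last first.
  by apply: big1 => y /eqP deg_y; rewrite mcoeff_subst_deg // deg_y.
transitivity ((subst (total_Sq 'X_[a]))@_e); last first.
  rewrite subst_total_Sq mcoeff_total_Sq_spike // mcoeff_subst_deg //.
  by rewrite -deg_e; lia.
rewrite [total_Sq _ in RHS]mpoly_suppE subst_sum raddf_sum /=.
rewrite [RHS](bigID (fun y => mdeg y == mdeg a + i)%N) /= [X in _ + X]big1 ?addr0 //.
by move=> y ne_y; rewrite mcoeff_subst_deg // -deg_e.
Qed.

(* The coefficient of a spike is unaffected by positive Steenrod operations,
   so composing it with linear substitutions kills all hit polynomials. *)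
Lemma mcoeff_subst_hit p (e : 'X_{1..n}) : is_spike e -> in_AplusP p -> (subst p)@_e = 0.
Proof.
move=> spike_e [s [s_ok ->]]; rewrite subst_sum raddf_sum /= big_seq.
apply: big1 => -[[|i w] f] /(allP s_ok) //= /andP[i_gt0 _].
rewrite /Sq subst_sum raddf_sum /=; apply: big1 => a _.
by rewrite /subst linearZ /= mcoeffZ -/(subst _) mcoeff_subst_Sq_mon // mulr0.
Qed.

Lemma subst_mon_cons l w : size l = k ->
  subst 'X_[mon k (l :: w)] =
  (\prod_(c < k | nth false l c) linear_form (nth [::] cols c)) * subst 'X_[mon k w] ^+ 2.
Proof.
rewrite /subst !comp_mpolyX -prodrXl => _.
rewrite [X in _ = X * _]big_mkcond /= -big_split /=; apply: eq_bigr => c _.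
rewrite tnth_mktuple !monE /= -muln2 exprD exprM; congr (_ * _).
by case: (nth false l c); rewrite ?expr1 ?expr0.
Qed.

Lemma mcoeff_sqr_mul (q z : Pk n) (d : nat) (l : bitseq) (es : word) :
  q \is d.-homog for mdeg -> size l = n -> (d <= count id l)%N ->
  (q * z ^+ 2)@_(mon n (l :: es)) =
  if d == count id l then q@_(mon n [:: l]) * z@_(mon n es) else 0.
Proof.
move=> /dhomogP homq szl le_d.
have cl : count id l = mdeg (mon n [:: l]).
  by rewrite mdeg_mon ?/wf /= ?szl ?eqxx // degw_cons /degw big_ord0 addn0.
rewrite [q in LHS]mpolyE [z in LHS]mpoly_suppE sqr_sum big_distrl raddf_sum /=.
have uvP u v : u \in msupp q ->
    ((u + (v *+ 2))%MM == mon n (l :: es)) =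
    [&& d == count id l, u == mon n [:: l] & v == mon n es].
  move=> /homq deg_u; apply/eqP/and3P => [/mnmP uvE|[_ /eqP -> /eqP ->]]; last first.
    by apply/mnmP => i; rewrite mnmDE mulmnE !monE /= addn0 muln2.
  have ule i : (mon n [:: l] i <= u i)%N.
    have := uvE i; rewrite mnmDE mulmnE !monE /= addn0.
    case: (nth false l i) => // uE; rewrite lt0n; apply: contra_eqN uE => /eqP ->.
    by apply/eqP => /(congr1 odd); rewrite oddD oddM andbF oddD odd_double.
  have uE : u = mon n [:: l].
    have le_ul : (mon n [:: l] <= u)%MM by apply/mnm_lepP.
    have deg0 : mdeg (u - mon n [:: l])%MM = 0%N.
      by have := mdegD (u - mon n [:: l])%MM (mon n [:: l]); rewrite submK // deg_u -cl; lia.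
    by move/eqP: deg0; rewrite mdeg_eq0 => /eqP sub0; rewrite -(submK le_ul) sub0 add0m.
  split; [by rewrite cl -uE deg_u | exact/eqP |].
  apply/eqP/mnmP => i; have := uvE i; rewrite uE mnmDE mulmnE !monE /=; lia.
have coefE u v : u \in msupp q -> (q@_u *: 'X_[u] * 'X_[v] ^+ 2)@_(mon n (l :: es)) =
    [&& d == count id l, u == mon n [:: l] & v == mon n es]%:R * q@_u :> 'F_2.
  by move=> uq; rewrite -scalerAl mcoeffZ mpolyXn -mpolyXD mcoeffX uvP // mulrC.
have sumE u : u \in msupp q ->
    (q@_u *: 'X_[u] * \sum_(v <- msupp z) 'X_[v] ^+ 2)@_(mon n (l :: es)) =
    (d == count id l)%:R * ((u == mon n [:: l])%:R * q@_u * z@_(mon n es)) :> 'F_2.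
  move=> uq; rewrite big_distrr raddf_sum /=; under eq_bigr do rewrite coefE //.
  rewrite [z in RHS]mpoly_suppE raddf_sum !big_distrr /=; apply: eq_bigr => v _.
  by rewrite mcoeffX; case: (d == _); case: (u == _); case: (v == _);
    rewrite ?mul0r ?mulr0 ?mul1r ?mulr1.
rewrite big_seq; under eq_bigr => u uq do rewrite sumE //.
rewrite -big_seq -big_distrr /=; case: ifP => _; last by rewrite mul0r.
rewrite mul1r -big_distrl /=; congr (_ * _).
rewrite [q in RHS]mpolyE raddf_sum /=; apply: eq_bigr => u _.
by rewrite mcoeffZ mcoeffX mulrC.
Qed.

Lemma mcoeff_mulX (q : Pk n) (i : 'I_n) (m : 'X_{1..n}) :
  (q * 'X_i)@_m = if (0 < m i)%N then q@_(m - U_(i))%MM else 0.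
Proof.
case: ifP => [m_i|m_i].
  have le_m : (U_(i) <= m)%MM by apply/mnm_lepP => j; rewrite mnm1E; case: eqP => // <-.
  by rewrite -{1}(submK le_m) addmC mcoeffMX.
rewrite [q in LHS]mpolyE big_distrl raddf_sum /=; apply: big1 => u _.
rewrite -scalerAl -mpolyXD mcoeffZ mcoeffX; case: eqP => [uE|_]; last by rewrite mulr0.
by move: m_i; rewrite -uE mnmDE mnm1E eqxx addn1.
Qed.

Lemma mon_clear (l : bitseq) (i : 'I_n) : nth false l i ->
  (mon n [:: l] - U_(i))%MM = mon n [:: set_nth false l i false].
Proof.
move=> li; apply/mnmP => j; rewrite mnmBE mnm1E !monE /= nth_set_nth /= eq_sym -val_eqE.
by case: eqP => [->|_]; rewrite ?li ?subn0.
Qed.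

End Substitution.

(* The coefficient of the squarefree monomial l in the product of the linear
   forms with coefficient vectors cs, by expansion along the first form. *)
Fixpoint minor (n : nat) (cs : seq bitseq) (l : bitseq) : bool :=
  if cs is col :: cs' then
    foldr (fun i b =>
      if nth false col i then
        if nth false l i then
          if minor n cs' (set_nth false l i false) then ~~ b else b
        else b
      else b) false (iota 0 n)
  else all negb l.

Lemma minorP n cs (l : bitseq) : size l = n ->
  (\prod_(col <- cs) linear_form n col)@_(mon n [:: l]) = (minor n cs l)%:R.
Proof.
elim: cs l => [|col cs IHcs] l szl.
  rewrite big_nil mcoeff1 /=; congr ((nat_of_bool _)%:R); apply/eqP/allP => [/mnmP m0 b|l0].
    case/(nthP false) => i; rewrite szl => lt_i <-.
    by have := m0 (Ordinal lt_i); rewrite monE mnm0E /= addn0; case: (nth false l i).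
  apply/mnmP => i; rewrite monE mnm0E /= addn0.
  by have := l0 (nth false l i) (mem_nth _ _); rewrite szl ltn_ord => /(_ isT); case: (nth _ _ _).
rewrite big_cons {1}/linear_form big_distrl raddf_sum /=.
pose f i := nth false col i && nth false l i && minor n cs (set_nth false l i false).
transitivity (\sum_(i < n) (f i)%:R : 'F_2).
  rewrite big_mkcond; apply: eq_bigr => i _; rewrite /f; case: (nth false col i) => //=.
  rewrite mulrC mcoeff_mulX monE /= addn0; case: (boolP (nth false l i)) => //= li.
  rewrite mon_clear // IHcs //; rewrite size_set_nth szl; apply/maxn_idPr; exact: ltn_ord.
rewrite -(big_mkord (fun=> true) (fun i => (f i)%:R)) /index_iota subn0.
elim: (iota 0 n) => [|i r IHr]; first by rewrite big_nil.
rewrite big_cons IHr /f /=; case: (nth false col i); case: (nth false l i) => /=;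
  rewrite ?add0r //; case: (minor n cs _) => /=; rewrite ?add0r //.
by case: (foldr _ _ _); apply/val_inj.
Qed.

(** One minor for each binary digit. The nested [if] stops at the first vanishing minor under
    call-by-value evaluation. *)
Fixpoint value (n : nat) (cols : seq bitseq) (w es : word) : bool :=
  match w, es with
  | l :: w', e :: es' => if minor n (mask l cols) e then value n cols w' es' else false
  | _, _ => true
  end.

Lemma big_mask_ord (R : Type) (idx : R) (op : Monoid.law idx) (T : Type) (x0 : T)
    (l : bitseq) (s : seq T) (F : T -> R) : size l = size s ->
  \big[op/idx]_(x <- mask l s) F x =
  \big[op/idx]_(i < size s | nth false l i) F (nth x0 s i).
Proof.
elim: l s => [|b l IHl] [|x s] //=; first by rewrite big_nil big_ord0.
case=> szl.
rewrite [RHS]big_mkcond big_ord_recl -big_mkcond /= -IHl //.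
by case: b; rewrite ?big_cons ?Monoid.mul1m.
Qed.

Section Values.
Variables (k n : nat) (cols : seq bitseq).
Hypothesis size_cols : size cols = k.

Lemma letter_form (l : bitseq) : size l = k ->
  \prod_(c < k | nth false l c) linear_form n (nth [::] cols c) =
  \prod_(col <- mask l cols) linear_form n col.
Proof. by move=> szl; rewrite (big_mask_ord _ [::]) size_cols. Qed.

Lemma letter_homog (l : bitseq) : size l = k ->
  \prod_(col <- mask l cols) linear_form n col \is (count id l).-homog for mdeg.
Proof.
move=> szl; rewrite -letter_form // (count_nth szl) big_mkcond /=.
apply: prod_homog => c _; case: (nth false l c); first exact: linear_form_homog.
exact: dhomog1.
Qed.

Lemma valueP w es : wf k w -> wf n es -> prof w = prof es ->
  (subst n cols 'X_[mon k w])@_(mon n es) = (value n cols w es)%:R.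
Proof.
have mon_nil m : mon m [::] = 0%MM by apply/mnmP => i; rewrite monE.
elim: w es => [|l w IHw] [|e es] //.
  by rewrite !mon_nil mpolyX0 /subst comp_mpoly1 mcoeff1 eqxx.
case/andP=> /eqP szl wfw /andP[/eqP sze wfes] [cle profE].
rewrite subst_mon_cons // letter_form // (mcoeff_sqr_mul _ _ (letter_homog szl) sze).
  rewrite cle eqxx minorP // IHw //=; case: (minor _ _ _); by rewrite ?mul1r ?mul0r.
by rewrite cle.
Qed.

(** At the first smaller letter there are too few linear forms to produce the dual letter, whatever
    the higher digits are. *)
Lemma value_lower w es i : wf k w -> wf n es -> (i < size w)%N -> (i < size es)%N ->
  (forall j, (j < i)%N -> nth 0%N (prof w) j = nth 0%N (prof es) j) ->
  (nth 0%N (prof w) i < nth 0%N (prof es) i)%N ->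
  (subst n cols 'X_[mon k w])@_(mon n es) = 0.
Proof.
elim: i w es => [|i IHi] [|l w] [|e es] //= /andP[/eqP szl wfw] /andP[/eqP sze wfes].
  move=> _ _ _ lt_le; rewrite subst_mon_cons // letter_form //.
  rewrite (mcoeff_sqr_mul _ _ (letter_homog szl) sze) ?(ltnW lt_le) //.
  by rewrite ltn_eqF.
move=> lt_iw lt_ie eqP_ lt_i; rewrite subst_mon_cons // letter_form //.
have cle : count id l = count id e by exact: (eqP_ 0%N).
rewrite (mcoeff_sqr_mul _ _ (letter_homog szl) sze) ?cle // eqxx.
by rewrite (IHi w es) ?mulr0 // => j lt_j; apply: (eqP_ j.+1).
Qed.

Lemma mcoeff_subst_lower es (y : 'X_{1..k}) : wf n es ->
  ltlex (omega y) (wfun (prof es)) -> (subst n cols 'X_[y])@_(mon n es) = 0.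
Proof.
move=> wfes [i [eq_i lt_i]].
have lt_ies : (i < size es)%N.
  by rewrite -size_prof ltnNge; apply: contraTN lt_i => le_i; rewrite /wfun nth_default.
(* Large enough both to hold all exponents of [y] and to include position i among the letters. *)
pose N := (mdeg y + i).+1.
have lt_y j : (y j < 2 ^ N)%N.
  apply: leq_trans (ltn_expl _ (isT : 1 < 2)%N) _; rewrite leq_exp2l //.
  by rewrite /N mdegE (bigD1 j) //=; lia.
rewrite -(mon_word_of lt_y) in eq_i lt_i *.
have wfy := wf_word_of N y; rewrite omega_mon // in lt_i.
apply: (value_lower (i := i)) => //; first by rewrite size_word_of /N; lia.
by move=> j lt_j; have := eq_i j lt_j; rewrite omega_mon.
Qed.

Lemma mcoeff_subst_in_minus es (r : Pk k) : wf n es ->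
  in_Pw_minus (prof es) r -> (subst n cols r)@_(mon n es) = 0.
Proof.
move=> wfes low; rewrite [r]mpoly_suppE subst_sum raddf_sum /= big_seq.
by apply: big1 => y /low[_]; apply: mcoeff_subst_lower.
Qed.

End Values.

(** * Bases from reduction and separation *)

(** Identifies sigma with the library order on monomials of one degree, which supplies well-founded
    induction. *)
Lemma ltlex_sigmaP k (u v : 'X_{1..k}) :
  mdeg u = mdeg v -> ltlex (sigma u) (sigma v) <-> (u < v)%O.
Proof.
move=> deguv; have sE (x : 'X_{1..k}) (i : 'I_k) : sigma x i = x i.
  by rewrite /sigma -mnm_nth.
split=> [[i [eq_i lt_i]]|/(ltmcP deguv)[i eq_i lt_i]].
  have lt_ik : (i < k)%N.
    by rewrite ltnNge; apply: contraTN lt_i => le_ki; rewrite /sigma !nth_default ?size_tuple.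
  apply/(ltmcP deguv); exists (Ordinal lt_ik) => [j lt_j|]; last by rewrite -!sE.
  by rewrite -!sE; apply: eq_i.
exists i; split=> [l lt_l|]; last by rewrite !sE.
have lt_lk := ltn_trans lt_l (ltn_ord i).
by rewrite -[l]/(nat_of_ord (Ordinal lt_lk)) !sE; apply: eq_i.
Qed.

Lemma word_of_weight k w (y : 'X_{1..k}) : has_weight y w ->
  mon k (word_of (size w) y) = y /\ prof (word_of (size w) y) = w.
Proof.
move=> wy; have lt_y : forall j, (y j < 2 ^ size w)%N.
  by apply: lt_omega => i le_i; rewrite wy /wfun nth_default.
split; first exact: mon_word_of.
apply: (@eq_from_nth _ 0%N); first by rewrite size_prof size_word_of.
move=> i _; rewrite -[LHS]/(wfun _ i) -(@omega_mon k); last exact: wf_word_of.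
by rewrite mon_word_of // wy.
Qed.

Lemma mdeg_weight k w (y : 'X_{1..k}) : has_weight y w -> mdeg y = degw w.
Proof.
move=> /word_of_weight[yE profE]; rewrite -{1}yE mdeg_mon ?wf_word_of //.
by rewrite profE.
Qed.

Section Basis.
Variables (k : nat) (w : seq nat) (B : seq 'X_{1..k}).
Local Notation P := (Pk k).
Implicit Types (y z b : 'X_{1..k}) (p q r : P) (s L : seq 'X_{1..k}).

Hypothesis uniqB : uniq B.
Hypothesis weightB : forall b, b \in B -> has_weight b w.
Hypothesis reduce : forall y, has_weight y w -> y \notin B -> exists zs,
  (forall z, z \in zs -> has_weight z w /\ ltlex (sigma z) (sigma y)) /\
  hit_mod_lower w ('X_[y] + \sum_(z <- zs) 'X_[z] : P).
(** Linear independence, one combination [c] at a time: the functional may depend on the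
    combination, so no dual basis is needed. *)
Hypothesis separate : forall c : pred 'X_{1..k}, (exists2 b, b \in B & c b) ->
  exists phi : {additive P -> 'F_2},
    [/\ forall p, in_AplusP p -> phi p = 0,
        forall r, in_Pw_minus w r -> phi r = 0
      & \sum_(b <- B | c b) phi 'X_[b] != 0].

Lemma reduce_to_basis y : has_weight y w -> exists L,
  (forall b, b \in L -> b \in B /\ (b <= y)%O) /\
  hit_mod_lower w ('X_[y] + \sum_(b <- L) 'X_[b] : P).
Proof.
elim/(@ltmwf k): y => y IHy wy; case: (boolP (y \in B)) => [yB|/(reduce wy)].
  exists [:: y]; split=> [b|]; first by rewrite inE => /eqP ->.
  by rewrite big_seq1 addpp; apply: hml0.
case=> zs [zsP hy].
have lt_z z : z \in zs -> has_weight z w /\ (z < y)%O.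
  move=> /zsP[wz /ltlex_sigmaP lt_zy]; split=> //; apply: lt_zy.
  by rewrite (mdeg_weight wz) (mdeg_weight wy).
have [L [LP hL]] : exists L, (forall b, b \in L -> b \in B /\ (b <= y)%O) /\
    hit_mod_lower w (\sum_(z <- zs) 'X_[z] + \sum_(b <- L) 'X_[b] : P).
  elim: zs lt_z {zsP hy} => [_|z zs IHzs lt_z].
    by exists [::]; rewrite !big_nil addr0; split=> //; apply: hml0.
  have [z' z'zs|L [LP hL]] := IHzs; first by apply: lt_z; rewrite inE z'zs orbT.
  have [wz lt_zy] := lt_z z (mem_head _ _); have [L' [L'P hL']] := IHy z lt_zy wz.
  exists (L' ++ L); split=> [b|].
    rewrite mem_cat => /orP[/L'P[bB le_b]|/LP //]; split=> //.
    exact: le_trans le_b (ltW lt_zy).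
  by rewrite big_cons big_cat addrACA; apply: hmlD.
exists L; split=> //; have := hmlD hy hL.
by rewrite -addrA [\sum_(z <- zs) _ + (_ + _)]addrA addpp add0r.
Qed.

Lemma sum_parity (V : zmodType) (F : 'X_{1..k} -> V) L :
  (forall x : V, x + x = 0) -> {subset L <= B} ->
  \sum_(b <- L) F b = \sum_(b <- B | odd (count_mem b L)) F b.
Proof.
move=> char2; elim: L => [_|x L IHL sub]; first by rewrite big_nil big_pred0.
rewrite big_cons IHL => [|y yL]; last by apply: sub; rewrite inE yL orbT.
have xB : x \in B by apply: sub; rewrite mem_head.
rewrite [RHS](_ : _ = \sum_(b <- B) ((if b == x then F b else 0)
                      + (if odd (count_mem b L) then F b else 0))); last first.
  rewrite big_mkcond /=; apply: eq_bigr => b _; rewrite [x == b]eq_sym oddD.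
  by rewrite oddb; case: (b == x); case: (odd _) => /=; rewrite ?addr0 ?add0r ?char2.
rewrite big_split /= -[X in _ = _ + X]big_mkcond (bigD1_seq x) //= eqxx.
by rewrite [X in _ = _ + X + _]big1 ?addr0 // => b /negPf ->.
Qed.

Lemma hit_lower_separated (c : pred 'X_{1..k}) b :
  b \in B -> c b -> hit_mod_lower w (\sum_(b <- B | c b) 'X_[b] : P) -> False.
Proof.
move=> bB cb [q [r [hq hr sumE]]].
have [|phi [phi_hit phi_low]] := separate (c := c); first by exists b.
by rewrite -raddf_sum sumE raddfD phi_hit // phi_low // addr0 eqxx.
Qed.

(** A reducible [y] is visibly inadmissible. Conversely, if [y] in [B] were hit modulo smaller
    monomials, reducing these would give a hit combination of [y] with smaller members of [B],
    against [separate]; this is why [reduce_to_basis] records the bound b <= y. *)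
Lemma admissible_basis y : has_weight y w -> admissible y <-> y \in B.
Proof.
move=> wy; split=> [adm_y|yB [vs [lt_vs hy]]].
  apply/negPn/negP => /(reduce wy)[zs [zsP [q [r [hq hr sumE]]]]]; apply: adm_y.
  (* Over F_2 the lower part [r] is the sum of its support, so its monomials serve as further
     witnesses. *)
  exists (zs ++ msupp r); split=> [v|].
    rewrite mem_cat => /orP[/zsP[wv lt_v]|/hr[degv lt_v]]; split.
    - by rewrite (mdeg_weight wv) (mdeg_weight wy).
    - by right; split=> // i; rewrite wv wy.
    - by rewrite degv (mdeg_weight wy).
    - left; case: lt_v => i [eq_i lt_i]; exists i; rewrite wy; split=> // l lt_l.
      by rewrite wy eq_i.
  by rewrite big_cat addrA sumE -mpoly_suppE -addrA addpp addr0.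
have [L [LP hL]] : exists L, (forall b, b \in L -> b \in B /\ (b < y)%O) /\
    hit_mod_lower w (\sum_(v <- vs) 'X_[v] + \sum_(b <- L) 'X_[b] : P).
  elim: vs lt_vs {hy} => [_|v vs IHvs lt_vs].
    by exists [::]; rewrite !big_nil addr0; split=> //; apply: hml0.
  have [v' v'vs|L [LP hL]] := IHvs; first by apply: lt_vs; rewrite inE v'vs orbT.
  have [degv [lt_om|[eq_om lt_v]]] := lt_vs v (mem_head _ _).
    exists L; split=> //; rewrite big_cons -addrA; apply: hmlD => //.
    apply: hml_lower => x; rewrite msuppX inE => /eqP ->.
    rewrite degv (mdeg_weight wy); split=> //.
    by case: lt_om => i [eq_i lt_i]; exists i; rewrite -wy; split=> // l lt_l; rewrite eq_i.
  have wv : has_weight v w by move=> i; rewrite eq_om wy.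
  have [L' [L'P hL']] := reduce_to_basis wv.
  exists (L' ++ L); split=> [b|]; last by rewrite big_cons big_cat addrACA; apply: hmlD.
  rewrite mem_cat => /orP[/L'P[bB le_b]|/LP //]; split=> //.
  by apply: le_lt_trans le_b _; apply/ltlex_sigmaP.
have := hmlD (hml_hit w hy) hL.
rewrite -addrA [\sum_(v <- vs) _ + (_ + _)]addrA addpp add0r.
rewrite -(big_cons _ _ y L (fun=> true) (fun b => 'X_[b])).
have subL : {subset y :: L <= B} by move=> b; rewrite inE => /orP[/eqP -> //|/LP[]].
rewrite (sum_parity _ (@addpp k) subL).
apply: (hit_lower_separated yB); rewrite /= eqxx.
(* All members of [L] are strictly below [y], so [y] occurs exactly once in [y :: L]. *)
by rewrite (count_memPn _) //; apply/negP => /LP[_]; rewrite ltxx.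
Qed.

Lemma dimQP_basis : dimQP_is k w (size B).
Proof.
exists [seq 'X_[b] | b <- B]; split.
- by rewrite size_map.
- move=> _ /mapP[b bB ->] y; rewrite msuppX inE => /eqP ->.
  by split; [apply: mdeg_weight; apply: weightB | right; apply: weightB].
- move=> m szm has_m [q [r [hq _ hr sumE]]].
  have sub_m : {subset mask m B <= B} by move=> b /mem_mask.
  have [b b_m] : exists b, b \in mask m B.
    case E: (mask m B) => [|b t]; last by exists b; rewrite mem_head.
    by move/(congr1 size): E; rewrite size_mask // => /eqP; rewrite eqn0Ngt -has_count has_m.
  apply: (@hit_lower_separated (mem (mask m B)) b); rewrite ?sub_m //.
  exists q, r; split=> //; rewrite -sumE -map_mask big_map -[LHS]big_filter.
  by rewrite -[in LHS](mask_filter m uniqB).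
move=> p pP; have [L [LP hL]] : exists L, {subset L <= B} /\
    hit_mod_lower w (p + \sum_(b <- L) 'X_[b]).
  rewrite [p]mpoly_suppE; move: pP; rewrite /in_Pw.
  elim: {p}(msupp p : seq _) => [_|y s IHs pP].
    by exists [::]; rewrite !big_nil addr0; split=> //; apply: hml0.
  have [y' y's|L [LP hL]] := IHs; first by apply: pP; rewrite inE y's orbT.
  have [degy [lt_y|wy]] := pP y (mem_head _ _).
    exists L; split=> //; rewrite big_cons -addrA; apply: hmlD => //.
    by apply: hml_lower => x; rewrite msuppX inE => /eqP ->.
  have [L' [L'P hL']] := reduce_to_basis wy.
  exists (L' ++ L); split=> [b|]; last by rewrite big_cons big_cat addrACA; apply: hmlD.
  by rewrite mem_cat => /orP[/L'P[]|/LP].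
pose m := [seq odd (count_mem b L) | b <- B]; exists m.
have maskE : \sum_(b <- mask m [seq 'X_[b] | b <- B]) b = \sum_(b <- L) 'X_[b] :> P.
  by rewrite -map_mask big_map -filter_mask big_filter -sum_parity //; apply: addpp.
case: hL => q [r [hq hr sumE]]; exists q, r; split=> //; last first.
  by rewrite maskE oppp sumE.
(* The hit part is a sum of elements of P_k(w), hence lies in P_k(w), as [in_Wsub] demands. *)
have -> : q = p + \sum_(b <- L) 'X_[b] + r by rewrite sumE -addrA addpp addr0.
move=> y /msuppD_le; rewrite mem_cat => /orP[/msuppD_le|/hr[degy lt_y]]; last first.
  by split=> //; left.
rewrite mem_cat => /orP[/pP //|/msupp_sum_le/flattenP[s /mapP[b]]].
rewrite filter_predT => bL ->; rewrite msuppX inE => /eqP ->.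
by split; [apply/mdeg_weight/weightB/LP | right; apply/weightB/LP].
Qed.

End Basis.

(** * The finite certificate *)

Section Certificate.
Local Open Scope nat_scope.

(* Entries (t, items) list relations among words of profile t.  An item is a
   list of pairs (r, h), to be read as the sum of the Sq^(2^r) h; once normalized
   by the rules of the preceding items, it yields a new rule with its greatest
   word as left-hand side.  The bits of the numbers in h are the letters. *)
Definition certificate : seq (seq nat * seq (seq (nat * seq nat))) := [::
  ([:: 3; 3], [::
    [:: (0,[:: 15; 3])]; [:: (0,[:: 15; 5])]; [:: (0,[:: 15; 9])]; [:: (0,[:: 15; 6])];
    [:: (0,[:: 15; 10])]; [:: (0,[:: 15; 12])]; [:: (0,[:: 23; 3])]; [:: (0,[:: 23; 5])];
    [:: (0,[:: 23; 17])]; [:: (0,[:: 23; 6])]; [:: (0,[:: 23; 18])]; [:: (0,[:: 23; 20])];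
    [:: (0,[:: 27; 3])]; [:: (0,[:: 27; 9])]; [:: (0,[:: 27; 17])]; [:: (0,[:: 27; 10])];
    [:: (0,[:: 27; 18])]; [:: (0,[:: 27; 24])]; [:: (0,[:: 29; 5])]; [:: (0,[:: 29; 9])];
    [:: (0,[:: 29; 17])]; [:: (0,[:: 29; 12])]; [:: (0,[:: 29; 20])]; [:: (0,[:: 29; 24])];
    [:: (0,[:: 30; 6])]; [:: (0,[:: 30; 10])]; [:: (0,[:: 30; 18])]; [:: (0,[:: 30; 12])];
    [:: (0,[:: 30; 20])]; [:: (0,[:: 30; 24])]; [:: (0,[:: 15; 17])]; [:: (0,[:: 15; 18])];
    [:: (0,[:: 15; 20])]; [:: (0,[:: 15; 24])]; [:: (0,[:: 23; 9])]; [:: (0,[:: 23; 10])];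
    [:: (0,[:: 23; 12])]; [:: (0,[:: 23; 24])]; [:: (0,[:: 27; 5])]; [:: (0,[:: 27; 6])];
    [:: (0,[:: 27; 12])]; [:: (0,[:: 27; 20])]; [:: (0,[:: 29; 6])]; [:: (0,[:: 29; 10])];
    [:: (0,[:: 29; 18])]]);
  ([:: 3; 3; 3], [::
    [:: (0,[:: 15; 15; 3])]; [:: (0,[:: 15; 15; 5])]; [:: (0,[:: 15; 15; 9])];
    [:: (0,[:: 15; 15; 6])]; [:: (0,[:: 15; 15; 10])]; [:: (0,[:: 15; 15; 12])];
    [:: (0,[:: 23; 23; 3])]; [:: (0,[:: 23; 23; 5])]; [:: (0,[:: 23; 23; 17])];
    [:: (0,[:: 23; 23; 6])]; [:: (0,[:: 23; 23; 18])]; [:: (0,[:: 23; 23; 20])];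
    [:: (0,[:: 27; 27; 3])]; [:: (0,[:: 27; 27; 9])]; [:: (0,[:: 27; 27; 17])];
    [:: (0,[:: 27; 27; 10])]; [:: (0,[:: 27; 27; 18])]; [:: (0,[:: 27; 27; 24])];
    [:: (0,[:: 29; 29; 5])]; [:: (0,[:: 29; 29; 9])]; [:: (0,[:: 29; 29; 17])];
    [:: (0,[:: 29; 29; 12])]; [:: (0,[:: 29; 29; 20])]; [:: (0,[:: 29; 29; 24])];
    [:: (0,[:: 30; 30; 6])]; [:: (0,[:: 30; 30; 10])]; [:: (0,[:: 30; 30; 18])];
    [:: (0,[:: 30; 30; 12])]; [:: (0,[:: 30; 30; 20])]; [:: (0,[:: 30; 30; 24])];
    [:: (1,[:: 13; 23; 3])]; [:: (1,[:: 13; 27; 3])]; [:: (1,[:: 21; 15; 9])];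
    [:: (1,[:: 21; 15; 17])]; [:: (1,[:: 21; 27; 3])]; [:: (1,[:: 25; 15; 17])];
    [:: (1,[:: 14; 23; 3])]; [:: (1,[:: 14; 23; 5])]; [:: (1,[:: 14; 23; 9])];
    [:: (1,[:: 14; 23; 17])]; [:: (1,[:: 14; 27; 3])]; [:: (1,[:: 14; 27; 5])];
    [:: (1,[:: 14; 27; 9])]; [:: (1,[:: 14; 27; 17])]; [:: (1,[:: 14; 29; 5])];
    [:: (1,[:: 14; 29; 9])]; [:: (1,[:: 22; 15; 10])]; [:: (1,[:: 22; 15; 18])];
    [:: (1,[:: 22; 15; 12])]; [:: (1,[:: 22; 15; 20])]; [:: (1,[:: 22; 27; 3])];
    [:: (1,[:: 22; 27; 5])]; [:: (1,[:: 22; 27; 9])]; [:: (1,[:: 22; 27; 17])];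
    [:: (1,[:: 22; 29; 5])]; [:: (1,[:: 22; 29; 17])]; [:: (1,[:: 26; 15; 18])];
    [:: (1,[:: 26; 15; 12])]; [:: (1,[:: 26; 15; 24])]; [:: (1,[:: 26; 23; 20])];
    [:: (1,[:: 26; 23; 24])]; [:: (1,[:: 26; 29; 9])]; [:: (1,[:: 26; 29; 17])];
    [:: (1,[:: 28; 15; 20])]; [:: (1,[:: 28; 15; 24])]; [:: (1,[:: 28; 23; 24])];
    [:: (1,[:: 14; 29; 17])]; [:: (1,[:: 22; 15; 24])]; [:: (1,[:: 22; 29; 9])];
    [:: (1,[:: 26; 15; 20])]; [:: (0,[:: 15; 15; 17])]; [:: (0,[:: 15; 15; 18])];
    [:: (0,[:: 15; 15; 20])]; [:: (0,[:: 15; 15; 24])]; [:: (0,[:: 23; 23; 9])];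
    [:: (0,[:: 23; 23; 10])]; [:: (0,[:: 23; 23; 12])]; [:: (0,[:: 23; 23; 24])];
    [:: (0,[:: 27; 27; 5])]; [:: (0,[:: 27; 27; 6])]; [:: (0,[:: 27; 27; 12])];
    [:: (0,[:: 27; 27; 20])]; [:: (0,[:: 29; 29; 6])]; [:: (0,[:: 29; 29; 10])];
    [:: (0,[:: 29; 29; 18])]]);
  ([:: 3; 3; 3; 3], [::
    [:: (2,[:: 7; 13; 23; 3])]; [:: (2,[:: 7; 14; 23; 3])]; [:: (2,[:: 7; 14; 23; 5])];
    [:: (2,[:: 11; 11; 29; 17])]; [:: (2,[:: 11; 11; 30; 18])]; [:: (2,[:: 11; 14; 27; 9])];
    [:: (2,[:: 19; 22; 27; 17])]; [:: (2,[:: 13; 13; 30; 20])]; [:: (2,[:: 13; 13; 30; 24])];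
    [:: (2,[:: 21; 21; 30; 24])]; [:: (2,[:: 19; 19; 27; 12])]; [:: (2,[:: 21; 21; 30; 10])];
    [:: (2,[:: 21; 14; 27; 12])]; [:: (2,[:: 21; 14; 29; 24])]; [:: (2,[:: 25; 14; 23; 24])];
    [:: (2,[:: 11; 11; 29; 3])]; [:: (2,[:: 11; 11; 30; 3])]; [:: (2,[:: 11; 19; 29; 5])];
    [:: (2,[:: 11; 19; 30; 6])]; [:: (2,[:: 11; 13; 23; 17])]; [:: (2,[:: 11; 14; 23; 18])];
    [:: (2,[:: 11; 14; 27; 17])]; [:: (2,[:: 19; 19; 23; 12])]; [:: (2,[:: 13; 13; 30; 5])];
    [:: (2,[:: 13; 13; 30; 9])]; [:: (2,[:: 13; 21; 30; 6])]; [:: (2,[:: 13; 25; 30; 10])];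
    [:: (2,[:: 13; 14; 23; 20])]; [:: (2,[:: 13; 14; 27; 24])]; [:: (2,[:: 21; 21; 30; 17])];
    [:: (2,[:: 21; 25; 30; 18])]; [:: (2,[:: 21; 14; 23; 24])]; [:: (2,[:: 21; 22; 27; 24])];
    [:: (2,[:: 11; 11; 23; 9])]; [:: (2,[:: 11; 11; 23; 10])]; [:: (2,[:: 11; 14; 23; 20])];
    [:: (2,[:: 19; 14; 23; 24])]; [:: (2,[:: 13; 13; 23; 12])]; [:: (2,[:: 13; 13; 27; 12])];
    [:: (2,[:: 21; 21; 27; 20])]; [:: (2,[:: 21; 21; 29; 10])]; [:: (2,[:: 21; 14; 15; 24])];
    [:: (2,[:: 21; 22; 27; 12])]; [:: (2,[:: 11; 11; 23; 12])]; [:: (2,[:: 11; 22; 29; 3])];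
    [:: (2,[:: 19; 14; 27; 12])]]);
  ([:: 4; 3], [::
    [:: (0,[:: 31; 3])]; [:: (0,[:: 31; 5])]; [:: (0,[:: 31; 9])]; [:: (0,[:: 31; 17])];
    [:: (0,[:: 31; 6])]; [:: (0,[:: 31; 10])]; [:: (0,[:: 31; 18])]; [:: (0,[:: 31; 12])];
    [:: (0,[:: 31; 20])]; [:: (0,[:: 31; 24])]]);
  ([:: 4; 3; 3], [::
    [:: (1,[:: 29; 15; 3])]; [:: (1,[:: 29; 23; 3])]; [:: (1,[:: 30; 15; 3])];
    [:: (1,[:: 30; 15; 5])]; [:: (1,[:: 30; 15; 9])]; [:: (1,[:: 30; 15; 17])];
    [:: (1,[:: 30; 23; 3])]; [:: (1,[:: 30; 23; 5])]; [:: (1,[:: 30; 23; 9])];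
    [:: (1,[:: 30; 23; 17])]; [:: (1,[:: 30; 27; 9])]; [:: (1,[:: 30; 27; 17])];
    [:: (1,[:: 29; 27; 3])]; [:: (1,[:: 30; 27; 3])]; [:: (1,[:: 30; 27; 5])];
    [:: (1,[:: 30; 29; 5])]; [:: (1,[:: 30; 29; 9])]; [:: (1,[:: 30; 29; 17])]]);
  ([:: 4; 3; 3; 3], [::
    [:: (1,[:: 27; 15; 15; 3])]; [:: (1,[:: 27; 23; 23; 3])]; [:: (1,[:: 27; 23; 23; 5])];
    [:: (1,[:: 27; 23; 23; 6])]; [:: (1,[:: 29; 15; 15; 5])]; [:: (1,[:: 29; 15; 15; 9])];
    [:: (1,[:: 29; 23; 23; 5])]; [:: (1,[:: 29; 23; 23; 17])]; [:: (1,[:: 29; 23; 23; 6])];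
    [:: (1,[:: 29; 27; 27; 9])]; [:: (1,[:: 29; 27; 27; 17])]; [:: (1,[:: 29; 27; 27; 10])];
    [:: (1,[:: 29; 27; 27; 18])]; [:: (1,[:: 30; 15; 15; 6])]; [:: (1,[:: 30; 15; 15; 10])];
    [:: (1,[:: 30; 15; 15; 12])]; [:: (1,[:: 30; 23; 23; 6])]; [:: (1,[:: 30; 23; 23; 18])];
    [:: (1,[:: 30; 23; 23; 20])]; [:: (1,[:: 30; 27; 27; 10])]; [:: (1,[:: 30; 27; 27; 18])];
    [:: (1,[:: 30; 27; 27; 24])]; [:: (1,[:: 30; 29; 29; 12])]; [:: (1,[:: 30; 29; 29; 20])];
    [:: (1,[:: 30; 29; 29; 24])]; [:: (1,[:: 27; 15; 15; 5])]; [:: (1,[:: 27; 15; 15; 6])];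
    [:: (1,[:: 29; 15; 15; 6])]; [:: (1,[:: 29; 15; 15; 10])]; [:: (1,[:: 29; 23; 23; 18])];
    [:: (1,[:: 29; 23; 23; 9])]; [:: (1,[:: 30; 23; 23; 10])]; [:: (1,[:: 30; 23; 23; 12])];
    [:: (1,[:: 30; 27; 27; 12])]; [:: (1,[:: 30; 27; 27; 20])]; [:: (1,[:: 29; 15; 15; 18])];
    [:: (1,[:: 29; 27; 27; 5])]; [:: (1,[:: 30; 27; 27; 6])]; [:: (1,[:: 30; 29; 29; 6])];
    [:: (1,[:: 30; 29; 29; 10])]; [:: (1,[:: 30; 29; 29; 18])]; [:: (1,[:: 29; 23; 23; 10])]]);
  ([:: 4; 3; 3; 3; 3], [::
    [:: (3,[:: 27; 11; 11; 23; 20])]; [:: (3,[:: 27; 11; 13; 30; 18])];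
    [:: (3,[:: 27; 11; 14; 27; 6])]; [:: (3,[:: 27; 11; 14; 30; 18])];
    [:: (3,[:: 27; 13; 13; 30; 20])]; [:: (3,[:: 27; 13; 25; 23; 5])];
    [:: (3,[:: 27; 14; 26; 23; 6])]; [:: (3,[:: 29; 13; 14; 29; 6])];
    [:: (3,[:: 29; 13; 14; 29; 10])]; [:: (3,[:: 29; 13; 14; 30; 3])];
    [:: (3,[:: 29; 13; 14; 30; 20])]; [:: (3,[:: 29; 13; 14; 30; 24])];
    [:: (3,[:: 29; 21; 22; 29; 18])]; [:: (3,[:: 29; 21; 22; 30; 24])];
    [:: (3,[:: 29; 14; 28; 23; 6])]; [:: (3,[:: 29; 14; 28; 27; 10])];
    [:: (3,[:: 29; 22; 28; 27; 18])]; [:: (2,[:: 27; 25; 15; 15; 17])];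
    [:: (2,[:: 27; 26; 15; 15; 18])]; [:: (2,[:: 29; 28; 15; 15; 20])];
    [:: (2,[:: 29; 28; 15; 15; 24])]; [:: (2,[:: 29; 28; 23; 23; 24])];
    [:: (3,[:: 27; 14; 26; 15; 18])]; [:: (3,[:: 29; 14; 28; 15; 20])];
    [:: (3,[:: 29; 22; 28; 23; 24])]; [:: (3,[:: 23; 7; 14; 27; 5])];
    [:: (3,[:: 23; 11; 13; 27; 17])]; [:: (3,[:: 23; 11; 14; 27; 18])];
    [:: (3,[:: 23; 13; 14; 29; 20])]; [:: (3,[:: 27; 13; 13; 27; 18])];
    [:: (3,[:: 27; 13; 13; 30; 5])]; [:: (3,[:: 27; 13; 14; 29; 12])];
    [:: (3,[:: 27; 13; 14; 29; 24])]; [:: (3,[:: 27; 21; 22; 29; 20])];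
    [:: (3,[:: 27; 21; 22; 29; 24])]; [:: (3,[:: 27; 13; 14; 30; 20])];
    [:: (3,[:: 27; 13; 28; 15; 20])]; [:: (3,[:: 27; 21; 22; 30; 12])];
    [:: (3,[:: 27; 21; 28; 23; 12])]; [:: (3,[:: 23; 7; 26; 15; 5])];
    [:: (3,[:: 23; 11; 11; 27; 12])]; [:: (3,[:: 23; 11; 14; 27; 20])];
    [:: (3,[:: 27; 13; 28; 15; 17])]; [:: (3,[:: 23; 11; 14; 23; 10])];
    [:: (3,[:: 27; 21; 22; 27; 20])]; [:: (3,[:: 23; 7; 7; 15; 24])];
    [:: (3,[:: 27; 21; 22; 27; 12])]; [:: (3,[:: 27; 13; 14; 23; 24])];
    [:: (3,[:: 27; 21; 22; 27; 18])]; [:: (3,[:: 23; 11; 14; 23; 12])];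
    [:: (3,[:: 27; 21; 22; 27; 10])]; [:: (3,[:: 27; 11; 22; 27; 5])]]);
  ([:: 4; 4], [::
    [:: (0,[:: 31; 7])]; [:: (0,[:: 31; 11])]; [:: (0,[:: 31; 19])]; [:: (0,[:: 31; 13])];
    [:: (0,[:: 31; 21])]; [:: (0,[:: 31; 25])]; [:: (0,[:: 31; 14])]; [:: (0,[:: 31; 22])];
    [:: (0,[:: 31; 26])]; [:: (0,[:: 31; 28])]]);
  ([:: 4; 4; 3], [::
    [:: (0,[:: 31; 31; 3])]; [:: (0,[:: 31; 31; 5])]; [:: (0,[:: 31; 31; 9])];
    [:: (0,[:: 31; 31; 17])]; [:: (0,[:: 31; 31; 6])]; [:: (0,[:: 31; 31; 10])];
    [:: (0,[:: 31; 31; 18])]; [:: (0,[:: 31; 31; 12])]; [:: (0,[:: 31; 31; 20])];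
    [:: (0,[:: 31; 31; 24])]]);
  ([:: 4; 4; 3; 3], [::
    [:: (2,[:: 23; 23; 15; 3])]; [:: (2,[:: 23; 23; 15; 5])]; [:: (2,[:: 23; 23; 15; 6])];
    [:: (2,[:: 27; 27; 15; 9])]; [:: (2,[:: 27; 27; 15; 10])]; [:: (2,[:: 27; 27; 23; 17])];
    [:: (2,[:: 27; 27; 23; 18])]; [:: (2,[:: 29; 29; 15; 12])]; [:: (2,[:: 29; 29; 23; 20])];
    [:: (2,[:: 29; 29; 27; 24])]; [:: (2,[:: 23; 23; 15; 24])]; [:: (2,[:: 23; 23; 15; 9])];
    [:: (2,[:: 23; 23; 15; 17])]; [:: (2,[:: 23; 23; 15; 10])]; [:: (2,[:: 23; 23; 15; 18])];
    [:: (2,[:: 23; 23; 15; 12])]; [:: (2,[:: 23; 23; 15; 20])]; [:: (2,[:: 27; 27; 15; 12])];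
    [:: (2,[:: 27; 27; 15; 24])]; [:: (2,[:: 27; 27; 23; 12])]; [:: (2,[:: 27; 27; 23; 20])];
    [:: (2,[:: 27; 27; 23; 24])]; [:: (2,[:: 27; 27; 15; 17])]; [:: (2,[:: 27; 27; 15; 18])];
    [:: (2,[:: 29; 29; 15; 20])]; [:: (2,[:: 29; 29; 15; 24])]; [:: (2,[:: 29; 29; 23; 24])]]);
  ([:: 4; 4; 3; 3; 3], [::
    [:: (3,[:: 23; 27; 13; 15; 3])]; [:: (3,[:: 23; 27; 14; 15; 3])];
    [:: (3,[:: 23; 29; 14; 15; 5])]; [:: (3,[:: 27; 29; 14; 15; 9])];
    [:: (3,[:: 27; 29; 22; 23; 17])]; [:: (3,[:: 27; 27; 11; 23; 17])];
    [:: (3,[:: 27; 27; 11; 23; 18])]; [:: (3,[:: 29; 29; 13; 23; 20])];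
    [:: (3,[:: 29; 29; 13; 27; 24])]; [:: (3,[:: 29; 29; 21; 27; 24])];
    [:: (2,[:: 23; 23; 27; 27; 3])]; [:: (2,[:: 23; 23; 29; 29; 5])];
    [:: (2,[:: 23; 23; 29; 29; 9])]; [:: (2,[:: 23; 23; 30; 30; 6])];
    [:: (2,[:: 23; 23; 30; 30; 10])]; [:: (2,[:: 23; 23; 30; 30; 12])];
    [:: (2,[:: 23; 27; 15; 15; 3])]; [:: (2,[:: 23; 29; 15; 15; 5])];
    [:: (2,[:: 23; 30; 15; 15; 6])]; [:: (2,[:: 27; 27; 29; 29; 9])];
    [:: (2,[:: 27; 27; 29; 29; 17])]; [:: (2,[:: 27; 27; 30; 30; 10])];
    [:: (2,[:: 27; 27; 30; 30; 18])]; [:: (2,[:: 27; 27; 30; 30; 12])];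
    [:: (2,[:: 27; 27; 30; 30; 20])]; [:: (2,[:: 27; 29; 15; 15; 9])];
    [:: (2,[:: 27; 29; 23; 23; 17])]; [:: (2,[:: 27; 30; 15; 15; 10])];
    [:: (2,[:: 27; 30; 23; 23; 18])]; [:: (2,[:: 29; 29; 30; 30; 12])];
    [:: (2,[:: 29; 29; 30; 30; 20])]; [:: (2,[:: 29; 29; 30; 30; 24])];
    [:: (2,[:: 29; 30; 15; 15; 12])]; [:: (2,[:: 29; 30; 23; 23; 20])];
    [:: (2,[:: 29; 30; 27; 27; 24])]; [:: (2,[:: 27; 29; 15; 15; 17])];
    [:: (2,[:: 27; 30; 15; 15; 18])]; [:: (2,[:: 29; 30; 15; 15; 20])];
    [:: (2,[:: 29; 30; 15; 15; 24])]; [:: (2,[:: 29; 30; 23; 23; 24])];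
    [:: (3,[:: 23; 23; 7; 15; 9])]; [:: (3,[:: 23; 23; 7; 15; 10])];
    [:: (3,[:: 23; 23; 7; 15; 12])]; [:: (3,[:: 23; 23; 19; 15; 9])];
    [:: (3,[:: 23; 23; 19; 15; 10])]; [:: (3,[:: 23; 23; 21; 15; 12])];
    [:: (3,[:: 27; 27; 11; 15; 12])]; [:: (3,[:: 27; 27; 19; 23; 20])];
    [:: (3,[:: 27; 27; 25; 15; 12])]; [:: (3,[:: 27; 27; 25; 23; 20])];
    [:: (2,[:: 23; 27; 23; 23; 3])]; [:: (2,[:: 23; 29; 15; 15; 3])];
    [:: (2,[:: 23; 29; 15; 15; 9])]; [:: (2,[:: 23; 29; 15; 15; 17])];
    [:: (2,[:: 23; 29; 23; 23; 5])]; [:: (2,[:: 23; 30; 15; 15; 3])];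
    [:: (2,[:: 23; 30; 15; 15; 5])]; [:: (2,[:: 23; 30; 15; 15; 10])];
    [:: (2,[:: 23; 30; 15; 15; 18])]; [:: (2,[:: 23; 30; 15; 15; 12])];
    [:: (2,[:: 23; 30; 15; 15; 20])]; [:: (2,[:: 23; 30; 15; 15; 24])];
    [:: (2,[:: 23; 30; 23; 23; 6])]; [:: (2,[:: 27; 29; 27; 27; 9])];
    [:: (2,[:: 27; 29; 27; 27; 17])]; [:: (2,[:: 27; 30; 15; 15; 9])];
    [:: (2,[:: 27; 30; 15; 15; 12])]; [:: (2,[:: 27; 30; 15; 15; 24])];
    [:: (2,[:: 27; 30; 23; 23; 17])]; [:: (2,[:: 27; 30; 23; 23; 20])];
    [:: (2,[:: 27; 30; 23; 23; 24])]; [:: (2,[:: 27; 30; 27; 27; 10])];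
    [:: (2,[:: 27; 30; 27; 27; 18])]; [:: (2,[:: 29; 30; 29; 29; 12])];
    [:: (2,[:: 29; 30; 29; 29; 20])]; [:: (2,[:: 29; 30; 29; 29; 24])];
    [:: (3,[:: 23; 23; 25; 15; 12])]; [:: (3,[:: 29; 29; 13; 15; 18])];
    [:: (2,[:: 23; 29; 27; 27; 9])]; [:: (2,[:: 23; 30; 27; 27; 10])];
    [:: (2,[:: 23; 30; 29; 29; 12])]; [:: (2,[:: 27; 29; 23; 23; 5])];
    [:: (2,[:: 27; 30; 15; 15; 20])]; [:: (2,[:: 27; 30; 23; 23; 6])];
    [:: (2,[:: 27; 30; 29; 29; 12])]; [:: (2,[:: 27; 30; 29; 29; 20])];
    [:: (2,[:: 29; 30; 15; 15; 3])]; [:: (2,[:: 29; 30; 23; 23; 6])];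
    [:: (2,[:: 29; 30; 27; 27; 10])]; [:: (2,[:: 29; 30; 27; 27; 18])];
    [:: (2,[:: 23; 29; 27; 27; 5])]; [:: (2,[:: 23; 30; 27; 27; 6])];
    [:: (2,[:: 23; 30; 29; 29; 6])]; [:: (2,[:: 27; 30; 29; 29; 10])];
    [:: (2,[:: 27; 30; 29; 29; 18])]; [:: (3,[:: 23; 23; 21; 15; 10])];
    [:: (3,[:: 23; 27; 11; 15; 12])]; [:: (2,[:: 27; 30; 15; 15; 17])];
    [:: (3,[:: 23; 23; 19; 15; 17])]; [:: (3,[:: 23; 23; 19; 15; 18])];
    [:: (3,[:: 23; 23; 21; 15; 20])]; [:: (3,[:: 23; 23; 25; 15; 10])];
    [:: (3,[:: 27; 27; 25; 15; 24])]; [:: (3,[:: 27; 27; 25; 23; 24])];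
    [:: (2,[:: 23; 23; 23; 23; 9])]; [:: (2,[:: 23; 23; 23; 23; 10])];
    [:: (2,[:: 23; 23; 23; 23; 12])]; [:: (2,[:: 27; 27; 27; 27; 12])];
    [:: (2,[:: 27; 27; 27; 27; 20])]; [:: (2,[:: 27; 29; 15; 15; 6])];
    [:: (2,[:: 23; 30; 15; 15; 17])]; [:: (2,[:: 27; 27; 27; 27; 5])];
    [:: (2,[:: 27; 27; 27; 27; 6])]; [:: (2,[:: 29; 29; 29; 29; 6])];
    [:: (2,[:: 29; 29; 29; 29; 10])]; [:: (2,[:: 29; 29; 29; 29; 18])];
    [:: (2,[:: 23; 29; 27; 27; 10])]; [:: (3,[:: 27; 29; 13; 23; 20])];
    [:: (2,[:: 23; 23; 30; 30; 9])]; [:: (2,[:: 23; 27; 27; 27; 5])];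
    [:: (2,[:: 23; 27; 27; 27; 6])]; [:: (2,[:: 23; 29; 29; 29; 6])];
    [:: (2,[:: 27; 27; 23; 23; 12])]; [:: (2,[:: 27; 29; 29; 29; 10])];
    [:: (2,[:: 27; 29; 29; 29; 18])]; [:: (2,[:: 27; 30; 23; 23; 12])];
    [:: (2,[:: 29; 29; 30; 30; 3])]; [:: (3,[:: 23; 23; 25; 15; 24])];
    [:: (3,[:: 27; 27; 19; 23; 12])]; [:: (2,[:: 27; 29; 23; 23; 6])];
    [:: (3,[:: 29; 29; 13; 23; 24])]; [:: (3,[:: 23; 23; 19; 15; 20])];
    [:: (3,[:: 23; 29; 14; 27; 5])]; [:: (3,[:: 27; 29; 14; 27; 17])];
    [:: (3,[:: 23; 29; 14; 27; 17])]; [:: (3,[:: 27; 27; 25; 23; 12])];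
    [:: (2,[:: 27; 30; 29; 29; 5])]; [:: (2,[:: 23; 29; 23; 23; 3])];
    [:: (2,[:: 23; 30; 23; 23; 3])]; [:: (2,[:: 23; 30; 23; 23; 5])];
    [:: (2,[:: 27; 30; 27; 27; 9])]; [:: (2,[:: 27; 30; 27; 27; 17])];
    [:: (2,[:: 23; 29; 27; 27; 6])]; [:: (2,[:: 27; 30; 27; 27; 5])]]);
  ([:: 4; 4; 3; 3; 3; 3], [::
    [:: (4,[:: 15; 15; 7; 19; 29; 20])]; [:: (4,[:: 15; 15; 7; 19; 29; 24])];
    [:: (4,[:: 15; 15; 7; 19; 30; 20])]; [:: (4,[:: 15; 15; 7; 19; 30; 24])];
    [:: (4,[:: 15; 15; 7; 21; 27; 20])]; [:: (4,[:: 15; 15; 7; 26; 15; 24])];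
    [:: (4,[:: 15; 15; 11; 19; 29; 24])]; [:: (4,[:: 15; 15; 11; 13; 27; 20])];
    [:: (4,[:: 15; 15; 11; 14; 23; 20])]; [:: (4,[:: 15; 15; 11; 14; 23; 24])];
    [:: (4,[:: 15; 15; 11; 22; 23; 20])]; [:: (4,[:: 15; 15; 11; 26; 15; 20])];
    [:: (4,[:: 15; 15; 11; 28; 29; 3])]; [:: (4,[:: 15; 27; 19; 28; 23; 5])];
    [:: (4,[:: 23; 27; 13; 13; 15; 6])]; [:: (4,[:: 15; 15; 11; 22; 30; 17])];
    [:: (4,[:: 15; 15; 11; 28; 23; 17])]; [:: (4,[:: 15; 23; 7; 11; 27; 12])];
    [:: (4,[:: 15; 27; 19; 21; 30; 10])]; [:: (4,[:: 15; 15; 11; 22; 29; 20])];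
    [:: (4,[:: 15; 15; 13; 26; 15; 20])]; [:: (4,[:: 15; 15; 7; 11; 29; 20])];
    [:: (4,[:: 15; 15; 7; 11; 23; 5])]; [:: (4,[:: 15; 15; 7; 11; 23; 6])];
    [:: (4,[:: 15; 15; 7; 13; 23; 6])]; [:: (4,[:: 15; 15; 11; 13; 27; 10])];
    [:: (4,[:: 15; 15; 11; 13; 29; 20])]; [:: (4,[:: 15; 15; 11; 13; 30; 20])];
    [:: (4,[:: 23; 23; 19; 21; 27; 18])]; [:: (4,[:: 15; 15; 11; 13; 30; 18])];
    [:: (4,[:: 15; 15; 19; 26; 27; 5])]; [:: (3,[:: 23; 29; 26; 23; 23; 3])];
    [:: (4,[:: 23; 27; 19; 25; 30; 3])]; [:: (4,[:: 23; 27; 21; 26; 23; 10])];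
    [:: (3,[:: 15; 29; 22; 27; 27; 3])]; [:: (4,[:: 15; 27; 13; 14; 27; 17])];
    [:: (4,[:: 15; 27; 13; 22; 27; 3])]; [:: (4,[:: 15; 15; 19; 22; 29; 6])];
    [:: (4,[:: 15; 15; 11; 21; 30; 24])]; [:: (4,[:: 15; 29; 13; 26; 30; 17])];
    [:: (4,[:: 15; 15; 11; 14; 23; 12])]; [:: (4,[:: 15; 15; 11; 13; 23; 12])];
    [:: (4,[:: 15; 15; 7; 11; 29; 6])]; [:: (4,[:: 15; 15; 11; 14; 29; 3])]]);
  ([:: 3; 1], [::
    [:: (0,[:: 15; 0])]; [:: (0,[:: 23; 0])]; [:: (0,[:: 27; 0])]; [:: (0,[:: 29; 0])];
    [:: (0,[:: 30; 0])]]);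
  ([:: 3; 3; 1], [::
    [:: (0,[:: 15; 15; 0])]; [:: (0,[:: 23; 23; 0])]; [:: (0,[:: 27; 27; 0])];
    [:: (0,[:: 29; 29; 0])]; [:: (0,[:: 30; 30; 0])]]);
  ([:: 3; 3; 3; 1], [::
    [:: (2,[:: 25; 22; 29; 0])]; [:: (2,[:: 25; 22; 30; 0])]; [:: (2,[:: 13; 13; 30; 0])];
    [:: (2,[:: 21; 21; 30; 0])]; [:: (2,[:: 25; 25; 30; 0])]; [:: (0,[:: 15; 15; 15; 0])];
    [:: (0,[:: 23; 23; 23; 0])]; [:: (0,[:: 27; 27; 27; 0])]; [:: (0,[:: 29; 29; 29; 0])];
    [:: (0,[:: 30; 30; 30; 0])]; [:: (2,[:: 21; 22; 27; 0])]; [:: (2,[:: 25; 14; 15; 0])]]);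
  ([:: 3; 3; 3; 3; 1], [::
    [:: (3,[:: 7; 7; 28; 29; 0])]; [:: (3,[:: 7; 7; 28; 30; 0])];
    [:: (3,[:: 11; 11; 28; 29; 0])]; [:: (3,[:: 11; 11; 28; 30; 0])];
    [:: (3,[:: 19; 19; 28; 23; 0])]; [:: (3,[:: 19; 19; 28; 27; 0])];
    [:: (3,[:: 19; 19; 28; 29; 0])]; [:: (3,[:: 19; 19; 28; 30; 0])];
    [:: (3,[:: 11; 25; 26; 29; 0])]; [:: (3,[:: 11; 25; 26; 30; 0])];
    [:: (3,[:: 19; 21; 22; 29; 0])]; [:: (3,[:: 19; 21; 22; 30; 0])];
    [:: (3,[:: 19; 25; 26; 29; 0])]; [:: (3,[:: 19; 25; 26; 30; 0])];
    [:: (3,[:: 13; 14; 28; 23; 0])]; [:: (3,[:: 21; 22; 28; 27; 0])];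
    [:: (0,[:: 15; 15; 15; 15; 0])]; [:: (0,[:: 23; 23; 23; 23; 0])];
    [:: (0,[:: 27; 27; 27; 27; 0])]; [:: (0,[:: 29; 29; 29; 29; 0])];
    [:: (0,[:: 30; 30; 30; 30; 0])]; [:: (0,[:: 30; 30; 29; 30; 0]); (1,[:: 28; 30; 29; 30; 0])];
    [:: (0,[:: 30; 30; 27; 30; 0]); (1,[:: 26; 30; 27; 30; 0])];
    [:: (0,[:: 30; 30; 23; 30; 0]); (1,[:: 22; 30; 23; 30; 0])];
    [:: (0,[:: 29; 29; 27; 29; 0]); (1,[:: 25; 29; 27; 29; 0])];
    [:: (0,[:: 29; 29; 23; 29; 0]); (1,[:: 21; 29; 23; 29; 0])]; [:: (3,[:: 11; 13; 22; 29; 0])];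
    [:: (3,[:: 11; 13; 22; 30; 0])]; [:: (3,[:: 11; 21; 22; 29; 0])];
    [:: (3,[:: 11; 21; 22; 30; 0])];
    [:: (0,[:: 30; 30; 29; 27; 0]); (1,[:: 28; 30; 29; 27; 0]); (2,[:: 26; 26; 29; 27; 0]); (2,[:: 28; 26; 29; 27; 0])];
    [:: (0,[:: 27; 27; 23; 27; 0]); (1,[:: 19; 27; 23; 27; 0])]; [:: (3,[:: 19; 21; 25; 30; 0])];
    [:: (3,[:: 11; 14; 26; 29; 0])]; [:: (3,[:: 7; 7; 26; 15; 0])];
    [:: (3,[:: 19; 21; 22; 27; 0])];
    [:: (0,[:: 30; 30; 27; 23; 0]); (1,[:: 26; 30; 27; 23; 0]); (2,[:: 22; 22; 27; 23; 0]); (2,[:: 26; 22; 27; 23; 0])];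
    [:: (0,[:: 30; 30; 29; 23; 0]); (1,[:: 28; 30; 29; 23; 0]); (2,[:: 22; 22; 29; 23; 0]); (2,[:: 28; 22; 29; 23; 0])];
    [:: (0,[:: 29; 29; 27; 23; 0]); (1,[:: 25; 29; 27; 23; 0]); (2,[:: 21; 21; 27; 23; 0]); (2,[:: 25; 21; 27; 23; 0])];
    [:: (3,[:: 7; 13; 21; 30; 0])]; [:: (3,[:: 7; 11; 11; 29; 0])]]);
  ([:: 4; 3; 3; 3; 3; 1], [::
    [:: (4,[:: 15; 19; 21; 26; 23; 0])]; [:: (4,[:: 23; 7; 11; 28; 29; 0])];
    [:: (4,[:: 27; 11; 11; 28; 29; 0])]; [:: (4,[:: 27; 11; 11; 28; 30; 0])];
    [:: (4,[:: 27; 19; 19; 28; 29; 0])]; [:: (4,[:: 27; 19; 19; 28; 30; 0])];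
    [:: (4,[:: 23; 7; 25; 26; 29; 0])]; [:: (4,[:: 23; 7; 25; 26; 30; 0])];
    [:: (4,[:: 15; 21; 25; 25; 30; 0])]; [:: (4,[:: 23; 19; 19; 28; 23; 0])];
    [:: (4,[:: 23; 13; 25; 25; 30; 0])]; [:: (4,[:: 15; 19; 21; 28; 29; 0])];
    [:: (4,[:: 15; 19; 22; 28; 30; 0])]; [:: (4,[:: 23; 11; 13; 26; 27; 0])];
    [:: (4,[:: 23; 11; 13; 28; 29; 0])]; [:: (4,[:: 23; 11; 14; 28; 30; 0])];
    [:: (4,[:: 27; 13; 21; 21; 30; 0])]; [:: (4,[:: 23; 7; 13; 28; 30; 0])];
    [:: (4,[:: 27; 11; 13; 28; 30; 0])]; [:: (4,[:: 27; 19; 21; 28; 30; 0])];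
    [:: (4,[:: 23; 11; 13; 22; 30; 0])]; [:: (4,[:: 27; 11; 21; 28; 23; 0])];
    [:: (4,[:: 15; 19; 21; 28; 30; 0])]; [:: (4,[:: 23; 11; 13; 28; 30; 0])];
    [:: (4,[:: 23; 7; 19; 19; 30; 0])]; [:: (4,[:: 23; 7; 21; 22; 15; 0])];
    [:: (4,[:: 23; 7; 21; 22; 27; 0])]]);
  ([:: 4; 4; 3; 3; 3; 3; 1], [::
    [:: (5,[:: 15; 15; 7; 11; 13; 30; 0])]])
].

Definition letter_of (n : nat) : bitseq := mkseq (fun c => odd (n %/ 2 ^ c)) 5.

Definition relations : seq (seq nat * seq (nat * word)) :=
  flatten [seq [seq (g.1, [seq (rh.1, map letter_of rh.2) | rh <- item]) | item <- g.2]
          | g <- certificate].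

Definition letters (t : nat) : seq bitseq :=
  [seq l <- [seq letter_of n | n <- iota 0 32] | count id l == t].

Definition letter_sub (l J : bitseq) : bool :=
  all (fun c => nth false l c ==> nth false J c) (iota 0 5).

Definition reducible (T : trie) (w : word) : bool := isSome (reduct T w).

(** Prefixes of irreducible words are irreducible up to rewriting, so pruning after each letter
    loses nothing and keeps the enumeration small. *)
Definition normals (T : trie) (t : seq nat) : seq word :=
  foldl (fun B a => [seq z <- [seq rcons b l | b <- B, l <- letters a] | ~~ reducible T z])
    [:: [::]] t.

Definition tails (tl : bool) (J : bitseq) : seq word :=
  if tl then [seq [:: l] | l <- letters 1 & letter_sub l J] else [:: [::]].

Definition bad_letters (J : bitseq) : seq bitseq :=
  [seq l <- letters 3 | l != J] ++ [seq l <- letters 1 | ~~ letter_sub l J].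

(* After more than two repetitions of the last letter J of b, a suffix J J J J l
   of the word is covered by the first condition. *)
Definition reducible_tails (T : trie) (N : seq word) : bool :=
  all (fun J => all (fun l => reducible T (nseq 4 J ++ [:: l])) (bad_letters J)) (letters 3) &&
  all (fun b => all (fun i => all (fun l =>
      reducible T (b ++ nseq i (last [::] b) ++ [:: l])) (bad_letters (last [::] b)))
    (iota 0 3)) N.

(** Outside the last of six letters an exponent is at most 31; inside it is at least 32, and only
    inspection shows that some lower digit is 1 as well. *)
Definition large_exponents (N : seq word) : bool :=
  all (fun b => all (fun c => (32 < expo b c)%N == nth false (last [::] b) c) (iota 0 5)) N.

(* Columns of the matrices adapted to J: the variables of J go to the first three
   coordinates in order, every other variable only to the coordinates of later
   elements of J and to the last coordinate.  The latter must occur, for otherwise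
   words with letters of size 4 get the value 0. *)
Definition free_columns (J : bitseq) (c : nat) : seq bitseq :=
  let h := count id (take c J) in
  if nth false J c then [:: mkseq (fun i => i == h) 4]
  else [seq x <- [seq mkseq (fun i => odd (n %/ 2 ^ i)) 4 | n <- iota 0 16]
       | ~~ has id (take h x)].

Definition flags (J : bitseq) : seq (seq bitseq) :=
  [seq F <- foldr (fun c Fs => [seq x :: F | x <- free_columns J c, F <- Fs])
              [:: [::]] (iota 0 5) | has (fun x => nth false x 3) F].

Definition all4 : bitseq := [:: true; true; true; true].
Definition first3 : bitseq := [:: true; true; true; false].
Definition unit_letter (n j : nat) : bitseq := mkseq (fun i => i == j) n.

(** The spike with exponents 63, 63, 63, 3. Appending copies of [first3] and a singleton among the
    first three coordinates again gives a spike. *)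
Definition duals6 : word := [:: all4; all4; first3; first3; first3; first3].

Definition dual_tails (tl : bool) : seq word :=
  if tl then [seq [:: unit_letter 4 j] | j <- iota 0 3] else [:: [::]].

(* A matrix adapted to J annihilates the letters after J in [letters 3], and
   separates the tails following J. *)
Definition triangular : bool :=
  let L := letters 3 in
  all (fun J => let i := index J L in all (fun F =>
    [&& size F == 5,
        all (fun J' => ~~ minor 4 (mask J' F) first3) (drop i.+1 L) &
        all (fun tl => let ts := tails tl J in
            all (fun tau => all (fun x => value 4 F tau x.1 == (x.2 == tau))
                              (zip (dual_tails tl) ts)) ts)
          [:: true; false]])
    (flags J)) L.

Definition xor_row (r s : bitseq) : bitseq := [seq x.1 (+) x.2 | x <- zip r s].

(** Gaussian elimination; [n] bounds the number of rows, and running out of it counts as failure. *)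
Fixpoint independent (n : nat) (rows : seq bitseq) : bool :=
  match rows, n with
  | [::], _ => true
  | r :: rs, n'.+1 =>
    let p := index true r in
    (p < size r)%N &&
    independent n' [seq (if nth false s p then xor_row r s else s) | s <- rs]
  | _, _ => false
  end.

Definition block (N : seq word) (J : bitseq) : seq word := [seq b <- N | last [::] b == J].

(** Rows are the words of a block, columns the matrices adapted to J. The bound 500 exceeds the 465
    normal words and hence the size of any block. *)
Definition full_rank (N : seq word) : bool :=
  all (fun J => independent 500 [seq [seq value 4 F b duals6 | F <- flags J] | b <- block N J])
    (letters 3).

Definition w6 : seq nat := [:: 4; 4; 3; 3; 3; 3].

Definition certified (T : trie) : bool :=
  let N := normals T w6 in
  [&& size N == 465, reducible_tails T N, large_exponents N & full_rank N].
Lemma triangularT : triangular.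
Proof. by vm_compute. Qed.

Lemma certifiedT : if build 5 Leaf relations is Some T then certified T else false.
Proof. by vm_compute. Qed.

End Certificate.

(** * Normal words and the meaning of the computed checks *)

Lemma rewrites_ctx k u w v Z : wf k u -> wf k v ->
  rewrites k w Z -> exists Z', rewrites k (u ++ w ++ v) Z'.
Proof.
move=> wfu wfv /(rewrites_cat wfv).
elim: u wfu (map _ _) => [_ Z' rw|l u IHu /= /andP[/eqP szl wfu] Z' /(IHu wfu)[Z'' rw]].
  by exists Z'.
by exists (map (cons l) Z''); apply: rewrites_cons.
Qed.

Lemma mem_letters l t : l \in letters t -> size l = 5 /\ count id l = t.
Proof.
by rewrite mem_filter => /andP[/eqP -> /mapP[n _ ->]]; rewrite size_mkseq.
Qed.

Lemma letters_mem l t : size l = 5 -> count id l = t -> l \in letters t.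
Proof.
move=> szl <-; rewrite mem_filter eqxx /=.
by move: l szl => [|[] [|[] [|[] [|[] [|[] [|? l]]]]]] // _; vm_compute.
Qed.

Section Normals.
Variable T : trie.
Hypothesis T_ok : trie_all (valid_rule 5) T.

Definition has_rewrite (w : word) := exists Z, rewrites 5 w Z.

Lemma has_rewrite_ctx u w v : wf 5 u -> wf 5 v -> has_rewrite w -> has_rewrite (u ++ w ++ v).
Proof. by move=> wu wv [Z]; apply: rewrites_ctx. Qed.

Lemma reducible_rewrite w : wf 5 w -> reducible T w -> has_rewrite w.
Proof.
by rewrite /reducible => wfw; case E: (reduct T w) => [R|//] _; exists R; apply: reductP E.
Qed.

Lemma normals_rcons ts t : normals T (rcons ts t) =
  [seq z <- [seq rcons b l | b <- normals T ts, l <- letters t] | ~~ reducible T z].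
Proof. by rewrite /normals foldl_rcons. Qed.

Lemma mem_normals ts w : w \in normals T ts -> wf 5 w /\ prof w = ts.
Proof.
elim/last_ind: ts w => [|ts t IHts] w; first by rewrite inE => /eqP ->.
rewrite normals_rcons mem_filter => /andP[_ /allpairsP[[b l] /= [/IHts[wfb profb] lt ->]]].
have [szl cl] := mem_letters lt.
by rewrite /wf all_rcons szl eqxx /prof map_rcons cl -/(prof b) profb.
Qed.

Lemma normals_or_rewrite ts w : wf 5 w -> prof w = ts -> w \in normals T ts \/ has_rewrite w.
Proof.
elim/last_ind: ts w => [|ts t IHts] w wfw; first by case: w wfw => // _ _; left; rewrite inE.
case/lastP: w wfw => [|b l] wfw; first by case: ts {IHts}.
rewrite /prof map_rcons => /rcons_inj[profb cl].
have := wfw; rewrite /wf all_rcons => /andP[/eqP szl wfb].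
case: (IHts b wfb profb) => [bN|rb]; last first.
  right; rewrite -cats1; apply: (@has_rewrite_ctx [::] b [:: l]) => //.
  by rewrite /wf /= szl.
case: (boolP (reducible T (rcons b l))) => [red|nred].
  by right; apply: reducible_rewrite.
left; rewrite normals_rcons mem_filter nred; apply/allpairsP; exists (b, l); split=> //.
exact: letters_mem.
Qed.

Lemma uniq_normals ts : uniq (normals T ts).
Proof.
elim/last_ind: ts => [//|ts t IHts]; rewrite normals_rcons filter_uniq //.
apply: allpairs_uniq => //.
  by apply: filter_uniq; vm_compute.
by move=> [b l] [b' l'] _ _ /= /rcons_inj[-> ->].
Qed.

End Normals.

(** If a combination vanishes in every column, it still vanishes after the pivot row has been added
    to the others, so by induction the remaining coefficients are 0; the pivot column then kills the
    first one. *)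
Lemma independentP n W rows (cf : bitseq) :
  independent n rows -> all (fun r : bitseq => size r == W) rows -> size cf = size rows ->
  has id cf -> exists2 p, (p < W)%N &
    foldr addb false [seq x.1 && nth false x.2 p | x <- zip cf rows].
Proof.
move=> ind szr szc hasc.
pose comb (cf : bitseq) rows p := foldr addb false [seq x.1 && nth false x.2 p | x <- zip cf rows].
have [/existsP[p comb_p]|/existsPn all0] := boolP [exists p : 'I_W, comb cf rows p].
  by exists p.
suff : ~~ has id cf by rewrite hasc.
have {}all0 p : (p < W)%N -> comb cf rows p = false.
  by move=> lt_p; apply/negbTE/(all0 (Ordinal lt_p)).
clear hasc; elim: n rows cf szc ind szr all0 => [|n IHn] [|r rs] [|c cs] //= [szc].
case/andP=> lt_p ind /andP[/eqP szr szrs] all0.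
set p0 := index true r in lt_p ind; rewrite szr in lt_p.
have rp0 : nth false r p0 = true by rewrite nth_index // -index_mem szr.
have combE q : (q < W)%N -> comb cs rs q = c && nth false r q.
  by move/all0; rewrite /comb /=; case: (c && _); case: (foldr _ _ _).
set rs' := [seq _ | s <- rs] in ind.
have szrs' : all (fun r : bitseq => size r == W) rs'.
  rewrite all_map; apply: sub_all szrs => s /= /eqP szs.
  by case: ifP => _; rewrite /xor_row ?size_map ?size_zip ?szs ?szr ?minnn eqxx.
have comb' q : (q < W)%N -> comb cs rs' q = comb cs rs q (+) (nth false r q && comb cs rs p0).
  move=> lt_q; rewrite /rs'.
  elim: rs cs szc szrs {ind szrs' combE all0 rs'} => [|s rs IHrs] [|b cs] //=.
    by rewrite andbF.
  case=> szc /andP[/eqP szs szrs]; rewrite /comb /= -!/(comb _ _ _) IHrs //.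
  case: ifP => sp; rewrite /xor_row ?(nth_map (false, false)) ?size_zip ?szs ?szr ?minnn ?nth_zip ?szs //=;
  by case: b; case: (nth false r q); case: (nth false s q); case: (comb cs rs q); case: (comb cs rs p0).
have cs0 : ~~ has id cs.
  apply: (IHn rs') => //; first by rewrite size_map.
  move=> q lt_q; rewrite comb' // !combE // rp0; by case: c {all0 combE szc}; case: (nth _ _ _).
have comb0 : comb cs rs p0 = false.
  elim: cs rs cs0 {szc szrs combE all0 ind rs' szrs' comb'} => [|b cs IHcs] [|s rs] //=.
  by case/norP=> /negPf nb /IHcs cs0; rewrite /comb /= nb; apply: cs0.
by rewrite negb_or cs0 andbT; move: (combE p0 lt_p); rewrite comb0 rp0 andbT => <-.
Qed.

(** Listing all increasing triples inside J turns the uniqueness of the triple into the computed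
    fact that the list has one entry. *)
Definition triples (J : bitseq) : seq (nat * nat * nat) :=
  [seq p <- [seq (q, k) | q <- [seq (i, j) | i <- iota 0 5, j <- iota 0 5], k <- iota 0 5]
  | [&& (p.1.1 < p.1.2)%N, (p.1.2 < p.2)%N, nth false J p.1.1, nth false J p.1.2
     & nth false J p.2]].

Lemma mem_triples J (i j k : 'I_5) : (i : nat, j : nat, k : nat) \in triples J =
  [&& (i < j)%N, (j < k)%N, nth false J i, nth false J j & nth false J k].
Proof.
rewrite mem_filter andb_idr // => _; apply/allpairsP; exists ((i : nat, j : nat), k : nat).
split=> //; last by rewrite mem_iota /=; have := ltn_ord k.
apply/allpairsP; exists (i : nat, j : nat).
by split=> //; rewrite mem_iota /=; [have := ltn_ord i | have := ltn_ord j].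
Qed.

Lemma triplesP J : J \in letters 3 -> exists p : 'I_5 * 'I_5 * 'I_5,
  triples J = [:: (p.1.1 : nat, p.1.2 : nat, p.2 : nat)] /\
  forall c : 'I_5, nth false J c = (c \in [:: p.1.1; p.1.2; p.2]).
Proof.
have/allP chk : all (fun J => if triples J is [:: p]
    then [&& (p.1.1 < 5)%N, (p.1.2 < 5)%N, (p.2 < 5)%N
      & all (fun c => nth false J c == (c \in [:: p.1.1; p.1.2; p.2])) (iota 0 5)]
    else false) (letters 3) by vm_compute.
move=> /chk; case: (triples J) => [|[[i j] k] [|? ?]] // /and4P[lti ltj ltk /allP bits].
exists (Ordinal lti, Ordinal ltj, Ordinal ltk); split=> // c.
have /eqP -> : nth false J c == (val c \in [:: i; j; k]) by apply: bits; rewrite mem_iota /= ltn_ord.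
by rewrite !inE -!val_eqE.
Qed.

Lemma unit_letterP l : l \in letters 1 -> exists j : 'I_5, l = unit_letter 5 j.
Proof.
have/allP chk : all (fun l => has (fun j => l == unit_letter 5 j) (iota 0 5)) (letters 1).
  by vm_compute.
move=> /chk /hasP[j]; rewrite mem_iota => /andP[_ ltj] /eqP ->.
by exists (Ordinal ltj).
Qed.

Lemma unit_letter_in (j : 'I_5) : unit_letter 5 j \in letters 1.
Proof.
have/allP chk : all (fun j => unit_letter 5 j \in letters 1) (iota 0 5) by vm_compute.
by apply: chk; rewrite mem_iota /= ltn_ord.
Qed.

Lemma nth_unit_letter n j c : (c < n)%N -> nth false (unit_letter n j) c = (c == j).
Proof. by move=> lt_c; rewrite nth_mkseq. Qed.

Lemma unit_letter_sub (j : 'I_5) J : letter_sub (unit_letter 5 j) J = nth false J j.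
Proof.
rewrite /letter_sub; apply/allP/idP => [/(_ (nat_of_ord j))|Jj c].
  by rewrite nth_unit_letter // mem_iota eqxx /= ltn_ord => ->.
by rewrite mem_iota => /andP[_ lt_c]; rewrite nth_unit_letter //; apply/implyP => /eqP ->.
Qed.

(** * Standard words *)

(* Unification would otherwise try to evaluate these lists. *)
Opaque letters flags normals relations triples.

Lemma mem_bad_letters l J : l \in bad_letters J =
  (l \in letters 3) && (l != J) || (l \in letters 1) && ~~ letter_sub l J.
Proof.
rewrite mem_cat; congr (_ || _); rewrite mem_filter; exact: andbC.
Qed.

Opaque bad_letters letter_sub.

Lemma nseq_or_break (l : bitseq) (m : word) :
  m = nseq (size m) l \/ exists i l' m', m = nseq i l ++ l' :: m' /\ l' != l.
Proof.
elim: m => [|a m IHm]; first by left.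
have [->|ne_al] := eqVneq a l; last by right; exists 0%N, a, m.
case: IHm => [{1}->|[i [l' [m' [-> ne]]]]]; first by left.
by right; exists i.+1, l', m'.
Qed.

Lemma mon_inj k u v : wf k u -> wf k v -> size u = size v -> mon k u = mon k v -> u = v.
Proof.
move=> wfu wfv szuv muv; have bit w i (j : 'I_k) : (i < size w)%N ->
    nth false (nth [::] w i) j = odd (mon k w j %/ 2 ^ i).
  move=> lt_i; have := alpha_expo j 0 lt_i; rewrite muln0 addn0 monE /alpha.
  by case: (odd _); case: (nth _ _ _).
apply: (@eq_from_nth _ [::]) => // i lt_i.
have szn w : wf k w -> (i < size w)%N -> size (nth [::] w i) = k.
  by move=> wfw lt_w; apply/eqP/(allP wfw)/mem_nth.
have lt_iv : (i < size v)%N by rewrite -szuv.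
apply: (@eq_from_nth _ false) => [|j]; first by rewrite !szn.
by rewrite szn // => lt_j; rewrite !(bit _ _ (Ordinal lt_j)) // muv.
Qed.

(** For d = 8 + t this is [w1 d] or, with the tail, [w2 d]; the tail is preceded by 6 + t = d - 2
    letters. *)
Definition weight (tl : bool) (t : nat) : seq nat :=
  [:: 4; 4] ++ nseq (4 + t) 3 ++ (if tl then [:: 1] else [::]).

Lemma value_cat n F u v a b : size u = size a ->
  value n F (u ++ v) (a ++ b) = value n F u a && value n F v b.
Proof.
elim: u a => [|l u IHu] [|m a] //= [szu]; rewrite IHu //.
by case: (minor _ _ _).
Qed.

Lemma value_nseq n F l m i : minor n (mask l F) m -> value n F (nseq i l) (nseq i m).
Proof. by move=> lm; elim: i => //= i ->; rewrite lm. Qed.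

Lemma expo_nseq i l c : expo (nseq i l) c = (nth false l c * (2 ^ i).-1)%N.
Proof.
elim: i => [|i IHi] /=; first by rewrite muln0.
rewrite IHi expnS; have := expn_gt0 2 i; case: (nth false l c) => //=; lia.
Qed.

Lemma addb_foldr (s : seq bool) :
  (foldr addb false s)%:R = \sum_(x <- s) x%:R :> 'F_2.
Proof.
elim: s => [|x s IHs]; first by rewrite big_nil.
rewrite big_cons -IHs /=; case: x => /=; last by rewrite add0r.
by case: (foldr _ _ _); apply/val_inj.
Qed.

Lemma size_tails tl J : J \in letters 3 -> size (tails tl J) = size (dual_tails tl).
Proof.
case: tl => // JL; have/allP : all (fun J => size (tails true J) == 3) (letters 3).
  by vm_compute.
by move/(_ J JL)/eqP ->.
Qed.

Lemma uniq_tails tl J : uniq (tails tl J).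
Proof.
case: tl => //; rewrite map_inj_uniq => [|? ? [] //]; apply: filter_uniq.
by vm_compute.
Qed.

Lemma mem_tails tl J tau : tau \in tails tl J ->
  wf 5 tau /\ prof tau = if tl then [:: 1%N] else [::].
Proof.
case: tl => [/mapP[l]|]; last by rewrite inE => /eqP ->.
by rewrite mem_filter => /andP[_ /mem_letters[/eqP szl cl]] -> /=; rewrite szl cl.
Qed.

Definition duals (t : nat) (e : word) : word := duals6 ++ nseq t first3 ++ e.

Lemma mem_dual_tails tl e : e \in dual_tails tl ->
  [/\ wf 4 e, prof e = if tl then [:: 1%N] else [::], expo e 3 = 0%N
    & forall i, (i < 3)%N -> exists b : bool, expo e i = b].
Proof.
case: tl; last by rewrite inE => /eqP ->; split=> // i _; exists false.
rewrite !inE => /or3P[] /eqP ->; split=> // [] [|[|[|//]]] _;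
  by [exists true | exists false].
Qed.

Lemma prof_duals tl t e : e \in dual_tails tl -> prof (duals t e) = weight tl t.
Proof.
move=> /mem_dual_tails[_ profe _ _].
by rewrite /duals !prof_cat profe /prof map_nseq.
Qed.

Lemma wf_duals tl t e : e \in dual_tails tl -> wf 4 (duals t e).
Proof. by move=> /mem_dual_tails[wfe _ _ _]; rewrite /duals !wf_cat wfe /wf all_nseq /= orbT. Qed.

Lemma spike_duals tl t e : e \in dual_tails tl -> is_spike (mon 4 (duals t e)).
Proof.
move=> /mem_dual_tails[_ _ e3 e012] j; rewrite monE /duals !expo_cat size_nseq expo_nseq.
have pos := expn_gt0 2 t; case: (ltnP j 3) => [lt_j|le_j]; last first.
  have -> : nat_of_ord j = 3 by have := ltn_ord j; lia.
  by exists 2; rewrite e3 muln0.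
have [b ->] := e012 j lt_j; exists (6 + t + b)%N; rewrite !expnD.
have -> : expo duals6 j = 63 by move: lt_j; case: (nat_of_ord j) => [|[|[|]]].
have -> : nth false first3 j = true by move: lt_j; case: (nat_of_ord j) => [|[|[|]]].
by case: b; rewrite /=; lia.
Qed.

Lemma flagP J F : J \in letters 3 -> F \in flags J ->
  [/\ size F = 5,
      forall J', J' \in letters 3 -> (index J (letters 3) < index J' (letters 3))%N ->
        minor 4 (mask J' F) first3 = false
    & forall tl tau x, tau \in tails tl J ->
        x \in zip (dual_tails tl) (tails tl J) -> value 4 F tau x.1 = (x.2 == tau)].
Proof.
move=> JL FJ.
have /allP/(_ J JL)/allP/(_ F FJ)/and3P[/eqP szF /allP later] := triangularT.
move=> /andP[tl1 /andP[tl0 _]].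
split=> // [J' J'L lt_JJ'|tl tau x tauJ xz].
  apply/negbTE/later; rewrite -(nth_index [::] J'L) -(subnKC lt_JJ') -nth_drop.
  by apply: mem_nth; rewrite size_drop ltn_sub2r ?index_mem //;
    apply: leq_ltn_trans lt_JJ' _; rewrite index_mem.
case: tl tauJ xz => tauJ xz.
  by have /allP/(_ tau tauJ)/allP/(_ x xz)/eqP := tl1.
by have /allP/(_ tau tauJ)/allP/(_ x xz)/eqP := tl0.
Qed.

Section Standard.
Variable T : trie.
Hypothesis T_ok : trie_all (valid_rule 5) T.
Hypothesis cert : certified T.
Local Notation N := (normals T w6).
Local Notation top b := (last [::] b).

Definition std_words (tl : bool) (t : nat) : seq word :=
  [seq b ++ nseq t (top b) ++ tau | b <- N, tau <- tails tl (top b)].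

Lemma normal_top b : b \in N ->
  [/\ wf 5 b, prof b = w6, size b = 6, top b \in letters 3
    & exists b0, b = rcons b0 (top b) /\ wf 5 b0].
Proof.
move=> /(mem_normals (T := T))[wfb profb].
have szb : size b = 6 by rewrite -size_prof profb.
case/lastP: b szb wfb profb => // b0 l szb wfb profb; rewrite last_rcons.
have /andP[/eqP szl wfb0] : (size l == 5) && wf 5 b0 by move: wfb; rewrite /wf all_rcons.
split=> //; last by exists b0.
apply: letters_mem => //; move: profb; rewrite /prof map_rcons.
by move/(congr1 (last 0%N)); rewrite last_rcons.
Qed.

Lemma bad_letters_size l J : l \in bad_letters J -> size l = 5.
Proof.
by rewrite mem_bad_letters => /orP[]/andP[/mem_letters[]].
Qed.

Lemma nseq_wf k i l : size l = k -> wf k (nseq i l).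
Proof. by move=> szl; rewrite /wf all_nseq szl eqxx orbT. Qed.

Lemma extend_rewrite b i l : b \in N -> l \in bad_letters (top b) ->
  has_rewrite (b ++ nseq i (top b) ++ [:: l]).
Proof.
case/and4P: cert => _ /andP[/allP red4 /allP red3] _ _ bN lbad.
have [wfb _ _ topb [b0 [bE wfb0]]] := normal_top bN.
have szl := bad_letters_size lbad; have [szt _] := mem_letters topb.
have [lt_i|le_i] := ltnP i 3.
  apply: (reducible_rewrite T_ok).
    by rewrite !wf_cat wfb nseq_wf //= szl.
  have /allP red3b := red3 b bN; have i3 : i \in iota 0 3 by rewrite mem_iota.
  by have /allP red3i := red3b i i3; apply: red3i.
(* The last letter of [b] supplies one of the four copies, the repetitions the other three. *)
have -> : b ++ nseq i (top b) ++ [:: l] =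
    (b0 ++ nseq (i - 3) (top b)) ++ (nseq 4 (top b) ++ [:: l]) ++ [::].
  rewrite {1}bE cats0 cat_rcons -catA; congr (_ ++ _).
  by rewrite -cat_cons -[_ :: nseq i _]/(nseq i.+1 _) catA -nseqD; congr (nseq _ _ ++ _); lia.
apply: has_rewrite_ctx => //; first by rewrite wf_cat wfb0 nseq_wf.
apply: (reducible_rewrite T_ok); first by rewrite wf_cat nseq_wf //= szl.
by have /allP := red4 _ topb; apply.
Qed.

(** If the first six letters are normal, the first later letter that breaks the pattern is a bad
    one, and the prefix ending there is reducible. *)
Lemma std_or_rewrite tl t x : wf 5 x -> prof x = weight tl t ->
  x \in std_words tl t \/ has_rewrite x.
Proof.
move=> wfx profx; set b := take 6 x; set m := take t (drop 6 x); set v := drop t (drop 6 x).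
have xE : x = b ++ m ++ v by rewrite !cat_take_drop.
have := wfx; rewrite xE !wf_cat => /and3P[wfb wfm wfv].
have profb : prof b = w6 by rewrite /prof map_take -/(prof x) profx /weight /= take0.
have prof6 : prof (drop 6 x) = nseq t 3 ++ (if tl then [:: 1] else [::]).
  by rewrite /prof map_drop -/(prof x) profx /weight /= drop0.
have profm : prof m = nseq t 3.
  by rewrite /prof map_take -/(prof _) prof6 take_size_cat ?size_nseq.
have profv : prof v = if tl then [:: 1] else [::].
  by rewrite /prof map_drop -/(prof _) prof6 drop_size_cat ?size_nseq.
have szm : size m = t by rewrite -size_prof profm size_nseq.
case: (normals_or_rewrite T_ok wfb profb) => [bN|rb]; last first.
  by right; apply: (@has_rewrite_ctx [::] b) => //; rewrite wf_cat wfm.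
have [_ _ _ topb _] := normal_top bN.
case: (nseq_or_break (top b) m) => [mE|[i [l [m' [mE ne_l]]]]]; last first.
  right; have -> : b ++ m ++ v = [::] ++ (b ++ nseq i (top b) ++ [:: l]) ++ (m' ++ v).
    by rewrite mE -!catA.
  have lm : l \in m by rewrite mE mem_cat mem_head orbT.
  have szl : size l = 5 by apply/eqP/(allP wfm).
  apply: has_rewrite_ctx => //.
    by move: wfm; rewrite mE !wf_cat wfv /= => /and3P[_ _ ->].
  have : count id l \in prof m by apply: map_f.
  rewrite profm mem_nseq => /andP[_ /eqP cl].
  apply: extend_rewrite => //; rewrite mem_bad_letters; apply/orP; left.
  by apply/andP; split; [exact: letters_mem szl cl | exact: ne_l].
rewrite mE szm; case: tl {profx prof6} profv => [|] profv; last first.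
  left; apply/allpairsPdep; exists b, [::]; rewrite bN /=; split=> //.
  by case: (v) profv.
have [l [vE szl cl]] : exists l, [/\ v = [:: l], size l = 5 & count id l = 1%N].
  case: (v) profv wfv => [|l [|? ?]] //= [cl] /andP[/eqP szl _].
  by exists l.
rewrite vE; case: (boolP (letter_sub l (top b))) => [sub|nsub].
  left; apply/allpairsPdep; exists b, [:: l]; split=> //.
  by apply: map_f; rewrite mem_filter sub (letters_mem szl cl).
right; apply: extend_rewrite => //.
rewrite mem_bad_letters; apply/orP; right.
by apply/andP; split; [exact: letters_mem szl cl | exact: nsub].
Qed.

(** [duals6] ends in [first3], so a nonzero value on [b] makes the minor of its last letter at
    [first3] equal to 1, and repetitions contribute nothing new. This holds even if the last letter
    is not J. *)
Lemma value_std (J : bitseq) (F : seq bitseq) (b tau e : word) (t : nat) :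
  J \in letters 3 -> F \in flags J -> b \in N ->
  value 4 F (b ++ nseq t (top b) ++ tau) (duals t e) =
  value 4 F b duals6 && value 4 F tau e.
Proof.
move=> JL FJ bN; have [_ _ szb _ [b0 [bE _]]] := normal_top bN.
rewrite /duals value_cat ?szb // value_cat ?size_nseq //.
case Vb : (value 4 F b duals6) => //=; rewrite value_nseq //.
have szb0 : size b0 = 5 by move: szb; rewrite bE size_rcons => -[].
move: Vb; rewrite {1}bE -cats1 -[duals6]/((take 5 duals6) ++ [:: first3]) value_cat ?szb0 //.
by case/andP=> _ /=; case: (minor _ _ _).
Qed.

Definition std_mons tl t : seq 'X_{1..5} := map (mon 5) (std_words tl t).

Lemma mem_std_words tl t w : w \in std_words tl t -> wf 5 w /\ prof w = weight tl t.
Proof.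
case/allpairsPdep => b [tau [bN tauJ ->]].
have [wfb profb _ topb _] := normal_top bN; have [wft proft] := mem_tails tauJ.
have [szt ct] := mem_letters topb.
by rewrite !wf_cat wfb wft nseq_wf // !prof_cat profb proft {1}/prof map_nseq ct.
Qed.

Lemma uniq_std_mons tl t : uniq (std_mons tl t).
Proof.
rewrite map_inj_in_uniq => [|u v /mem_std_words[wfu profu] /mem_std_words[wfv profv]].
  apply: allpairs_uniq_dep => [|b bN|[b tau] [b' tau'] /allpairsPdep[x [y [xN yx xyE]]]].
  - exact: uniq_normals.
  - exact: uniq_tails.
  case/allpairsPdep => x' [y' [x'N y'x' xy'E]] /=; case: xyE xy'E => -> -> [-> ->].
  have [_ _ szx _ _] := normal_top xN; have [_ _ szx' _ _] := normal_top x'N.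
  move/eqP; rewrite eqseq_cat ?szx ?szx' // => /andP[/eqP <-].
  by rewrite eqseq_cat ?size_nseq // => /andP[_ /eqP <-].
by apply: mon_inj => //; rewrite -size_prof profu -profv size_prof.
Qed.

Lemma weight_std_mons tl t y : y \in std_mons tl t -> has_weight y (weight tl t).
Proof.
by case/mapP=> w /mem_std_words[wfw profw] -> i; rewrite omega_mon // profw.
Qed.

Lemma reduce_std tl t y : has_weight y (weight tl t) -> y \notin std_mons tl t ->
  exists zs, (forall z, z \in zs -> has_weight z (weight tl t) /\ ltlex (sigma z) (sigma y)) /\
    hit_mod_lower (weight tl t) ('X_[y] + \sum_(z <- zs) 'X_[z] : Pk 5).
Proof.
move=> wy ynstd; have [yE profy] := word_of_weight wy.
case: (std_or_rewrite (wf_word_of _ y) profy) => [std|[Z [_ profZ nZ ltZ]]].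
  by case/negP: ynstd; rewrite -yE; apply: map_f.
exists (map (mon 5) Z); split=> [_ /mapP[z zZ ->]|].
  split; last by rewrite -[in X in ltlex _ X]yE; apply: ltZ.
  have /andP[wfz /eqP profz] := allP profZ z zZ.
  by move=> i; rewrite omega_mon // profz profy.
have := nZ [::] [::] isT isT; rewrite cats0 profy big_cons !cats0 yE big_map.
by under eq_bigr do rewrite cats0.
Qed.

Lemma separate_std tl t (c : pred 'X_{1..5}) : (exists2 b, b \in std_mons tl t & c b) ->
  exists phi : {additive Pk 5 -> 'F_2},
    [/\ forall p, in_AplusP p -> phi p = 0,
        forall r, in_Pw_minus (weight tl t) r -> phi r = 0
      & \sum_(b <- std_mons tl t | c b) phi 'X_[b] != 0].
Proof.
case=> _ /mapP[_ /allpairsPdep[b0 [tau0 [b0N tau0J ->]]] ->] c0.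
pose cw b tau := c (mon 5 (b ++ nseq t (top b) ++ tau)).
(* The least i with [P i] is the position of the first letter J occurring as last letter in the
   combination; functionals adapted to J kill the words with later letters. *)
pose P i := has (fun b => (index (top b) (letters 3) == i) && has (cw b) (tails tl (top b))) N.
have exP : exists i, P i.
  exists (index (top b0) (letters 3)); apply/hasP; exists b0; rewrite // eqxx.
  by apply/hasP; exists tau0.
case: (ex_minnP exP) => i /hasP[b1 b1N /andP[/eqP topb1 /hasP[tau1 tau1J c1]]] min_i.
set J := top b1 in topb1 tau1J; have [_ _ _ JL _] := normal_top b1N.
have [k [lt_k tauE]] : exists k, (k < size (dual_tails tl))%N /\ tau1 = nth [::] (tails tl J) k.
  by exists (index tau1 (tails tl J)); rewrite nth_index // -(size_tails tl JL) index_mem.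
(* The dual tail in the position of [tau1] takes the value 1 at [tau1] and 0 at the other tails
   following J. *)
set e := nth [::] (dual_tails tl) k.
have e_dual : e \in dual_tails tl by apply: mem_nth.
have e_tau : (e, tau1) \in zip (dual_tails tl) (tails tl J).
  rewrite /e tauE -nth_zip ?size_tails //; apply: mem_nth.
  by rewrite size_zip size_tails // minnn.
pose row b := [seq value 4 F b duals6 | F <- flags J].
have ind : independent 500 [seq row b | b <- block N J].
  by case/and4P: cert => _ _ _ /allP/(_ J JL).
(* Among the words with last letter J only those ending in [tau1] count; [b1] makes their
   coefficient vector nonzero, so some column, that is some matrix [F], detects it. *)
have [||| p lt_p rank] := independentP (W := size (flags J)) (cf := [seq cw b tau1 | b <- block N J]) ind.
- by rewrite all_map; apply/allP => b _ /=; rewrite size_map.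
- by rewrite !size_map.
- apply/hasP; exists true => //; apply/mapP; exists b1; last by rewrite c1.
  by rewrite mem_filter eqxx.
set F := nth [::] (flags J) p.
have FJ : F \in flags J by apply: mem_nth.
have [szF later dualF] := flagP JL FJ.
exists (mcoeff (mon 4 (duals t e)) \o comp_mpoly [tuple linear_form 4 (nth [::] F c) | c < 5]).
split=> [q hq|r hr|] /=.
- exact: (mcoeff_subst_hit F (spike_duals t e_dual)).
- apply: (mcoeff_subst_in_minus szF (wf_duals t e_dual)).
  by rewrite (prof_duals t e_dual).
rewrite /std_mons big_map big_mkcond big_allpairs_dep /=.
(* The sum over tails collapses to [tau1] for words of the block of J and to 0 for the others. *)
have inner b : b \in N -> \sum_(tau <- tails tl (top b))
     (if cw b tau then (subst 4 F 'X_[mon 5 (b ++ nseq t (top b) ++ tau)])@_(mon 4 (duals t e))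
      else 0) =
    if top b == J then (cw b tau1 && value 4 F b duals6)%:R else 0 :> 'F_2.
  move=> bN; have [_ _ _ topb [b' [bE _]]] := normal_top bN.
  have valE tau : tau \in tails tl (top b) ->
      (subst 4 F 'X_[mon 5 (b ++ nseq t (top b) ++ tau)])@_(mon 4 (duals t e)) =
      (value 4 F b duals6 && value 4 F tau e)%:R.
    move=> tauJ; have [wfw profw] : wf 5 (b ++ nseq t (top b) ++ tau) /\
        prof (b ++ nseq t (top b) ++ tau) = weight tl t.
      by apply: mem_std_words; apply/allpairsPdep; exists b, tau.
    rewrite (valueP szF wfw (wf_duals t e_dual)) ?(value_std _ _ _ JL FJ bN) //.
    by rewrite profw (prof_duals t e_dual).
  case: eqP => [topE|ne_top]; last first.
    rewrite big_seq big1 // => tau tauJ; case: ifP => // c_tau; rewrite valE //.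
    have le_i : (i <= index (top b) (letters 3))%N.
      apply: min_i; apply/hasP; exists b => //; rewrite eqxx; apply/hasP.
      by exists tau.
    have lt_i : (index J (letters 3) < index (top b) (letters 3))%N.
      rewrite topb1 ltn_neqAle le_i andbT; apply/eqP => iE; case: ne_top.
      by rewrite -(nth_index [::] topb) -iE -topb1 nth_index.
    have min0 := later _ topb lt_i.
    have -> : value 4 F b duals6 = false; last by [].
    have [_ _ szb _ _] := normal_top bN.
    have szb' : size b' = 5 by move: szb; rewrite bE size_rcons => -[].
    rewrite bE -cats1 -[duals6]/((take 5 duals6) ++ [:: first3]) value_cat ?szb' //=.
    by rewrite min0 andbF.
  have tau1b : tau1 \in tails tl (top b) by rewrite topE.
  rewrite (bigD1_seq tau1) //=; last exact: uniq_tails.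
  rewrite big_seq_cond big1 ?addr0 => [|tau /andP[tauJ ne_tau]]; last first.
    case: ifP => // _; rewrite valE // (dualF tl tau (e, tau1)) //=; last first.
      by move: tauJ; rewrite topE.
    by rewrite eq_sym (negPf ne_tau) andbF.
  rewrite valE // (dualF tl tau1 (e, tau1)) //= eqxx andbT.
  by case: (cw b tau1).
rewrite big_seq (eq_bigr _ inner) -big_seq -big_mkcond.
rewrite (_ : \sum_(b <- _ | _) _ = (foldr addb false [seq x.1 && nth false x.2 p |
   x <- zip [seq cw b tau1 | b <- block N J] [seq row b | b <- block N J]])%:R); first by rewrite rank.
rewrite addb_foldr big_map -[LHS]big_filter -/(block N J).
elim: (block N J) => [|b bs IHb]; first by rewrite /= !big_nil.
rewrite /= !big_cons IHb /=; congr (_%:R + _); congr (nat_of_bool (_ && _)).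
by rewrite (nth_map [::]).
Qed.

(** Repeating the last letter only enlarges exponents of its own variables, so the six-letter check
    decides all lengths. *)
Lemma large_expo b t (c : 'I_5) : b \in N ->
  (32 < mon 5 (b ++ nseq t (top b)) c)%N = nth false (top b) c.
Proof.
move=> bN; have [_ _ szb _ _] := normal_top bN.
case/and4P: cert => _ _ /allP/(_ b bN)/allP large _.
have c5 : (c : nat) \in iota 0 5 by rewrite mem_iota /= ltn_ord.
have := elimT eqP (large c c5).
rewrite monE expo_cat szb expo_nseq.
case: (nth _ _ _) => [lt_b|]; first by rewrite (leq_trans lt_b) ?leq_addr.
by rewrite mul0n muln0 addn0.
Qed.

Lemma std_monsP tl t y : has_weight y (weight tl t) ->
  admissible y <-> y \in std_mons tl t.
Proof.
apply: admissible_basis.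
- exact: uniq_std_mons.
- exact: reduce_std.
- exact: separate_std.
Qed.

Lemma dimQP_std tl t : dimQP_is 5 (weight tl t) (size (std_mons tl t)).
Proof.
apply: dimQP_basis.
- exact: uniq_std_mons.
- exact: weight_std_mons.
- exact: reduce_std.
- exact: separate_std.
Qed.

Lemma size_std_mons tl t : size (std_mons tl t) = (465 * if tl then 3 else 1)%N.
Proof.
case/and4P: cert => /eqP szN _ _ _; rewrite size_map size_allpairs_dep.
rewrite (_ : [seq _ | b <- N] = [seq (if tl then 3 else 1)%N | b <- N]); last first.
  apply/eq_in_map => b bN; have [_ _ _ topb _] := normal_top bN.
  by rewrite size_tails //; case: (tl).
by rewrite sumnE big_map big_const_seq count_predT szN iter_addn_0 mulnC.
Qed.

Lemma std_mons1P t x : reflect (exists2 b, b \in N & x = mon 5 (b ++ nseq t (top b)))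
  (x \in std_mons false t).
Proof.
apply: (iffP mapP) => [[w /allpairsPdep[b [tau [bN + ->]]] ->]|[b bN ->]].
  by rewrite inE => /eqP ->; exists b; rewrite // cats0.
exists (b ++ nseq t (top b) ++ [::]); last by rewrite cats0.
by apply/allpairsPdep; exists b, [::]; rewrite inE.
Qed.

Lemma std_mons2P t y : reflect (exists b (j : 'I_5), [/\ b \in N, nth false (top b) j &
    y = (mon 5 (b ++ nseq t (top b)) + U_(j) *+ (2 ^ (6 + t)))%MM])
  (y \in std_mons true t).
Proof.
have monU b (j : 'I_5) : b \in N -> mon 5 (b ++ nseq t (top b) ++ [:: unit_letter 5 j]) =
    (mon 5 (b ++ nseq t (top b)) + U_(j) *+ (2 ^ (6 + t)))%MM.
  move=> bN; have [_ _ szb _ _] := normal_top bN.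
  apply/mnmP => c; rewrite mnmDE mulmnE mnm1E !monE catA expo_cat size_cat size_nseq szb.
  by rewrite /= nth_unit_letter ?ltn_ord // double0 addn0 -val_eqE eq_sym mulnC.
apply: (iffP mapP) => [[w /allpairsPdep[b [tau [bN tauT ->]]] ->]|[b [j [bN Jj ->]]]].
  move: tauT => /mapP[l]; rewrite mem_filter => /andP[sub /unit_letterP[j lE]] ->.
  by exists b, j; rewrite lE monU // -unit_letter_sub -lE.
exists (b ++ nseq t (top b) ++ [:: unit_letter 5 j]); last by rewrite monU.
apply/allpairsPdep; exists b, [:: unit_letter 5 j]; split=> //.
by apply: map_f; rewrite mem_filter unit_letter_sub Jj unit_letter_in.
Qed.

Lemma good_tripleP b t p : b \in N ->
  good_triple (mon 5 (b ++ nseq t (top b))) p <->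
  triples (top b) = [:: (p.1.1 : nat, p.1.2 : nat, p.2 : nat)].
Proof.
move=> bN; have [_ _ _ topb _] := normal_top bN; have [q [trE _]] := triplesP topb.
rewrite /good_triple !large_expo //; split=> [[lt1 lt2 p1 p2 p3]|].
  have := mem_triples (top b) p.1.1 p.1.2 p.2; rewrite lt1 lt2 p1 p2 p3 trE inE => /eqP ->.
  by [].
move=> E; have := mem_triples (top b) p.1.1 p.1.2 p.2; rewrite E mem_head.
by move/esym/and5P.
Qed.

End Standard.

(** * Translation to d and conclusion *)

Lemma weight_w1 t : w1 (8 + t) = weight false t.
Proof. by rewrite /weight cats0 /w1 (_ : 8 + t - 4 = 4 + t)%N //; lia. Qed.

Lemma weight_w2 t : w2 (8 + t) = weight true t.
Proof. by rewrite /w2 weight_w1 /weight -!catA. Qed.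

Theorem theorem3p12 (d : nat) (hd : (8 <= d)%N) :
  (forall x : 'X_{1..5}, admissible x -> has_weight x (w1 d) ->
     exists! J : 'I_5 * 'I_5 * 'I_5, good_triple x J)
  /\ (forall y : 'X_{1..5},
        (admissible y /\ has_weight y (w2 d)) <->
        (exists (x : 'X_{1..5}) (J : 'I_5 * 'I_5 * 'I_5) (j : 'I_5),
           [/\ admissible x, has_weight x (w1 d), good_triple x J,
               j \in [:: J.1.1; J.1.2; J.2]
             & ('X_[y] : Pk 5) = 'X_[x] * 'X_j ^+ (2 ^ (d - 2))]))
  /\ dimQP_is 5 (w2 d) 1395.
Proof.
have := certifiedT; case E: (build 5 Leaf relations) => [T|//] cert.
have T_ok : trie_all (valid_rule 5) T by apply: buildP E.
rewrite -(subnKC hd); set t := (d - 8)%N; rewrite weight_w1 weight_w2.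
have triple_of b : b \in normals T w6 -> exists p : 'I_5 * 'I_5 * 'I_5,
    good_triple (mon 5 (b ++ nseq t (last [::] b))) p /\
    forall c : 'I_5, nth false (last [::] b) c = (c \in [:: p.1.1; p.1.2; p.2]).
  move=> bN; have [_ _ _ topb _] := normal_top bN.
  have [p [trE bits]] := triplesP topb; exists p; split; last exact: bits.
  by have [_] := good_tripleP cert t p bN; apply.
split=> [x adm_x wx|].
  have /std_mons1P[b bN ->] := (std_monsP T_ok cert wx).1 adm_x.
  have [p [good_p _]] := triple_of b bN; exists p; split; first exact: good_p.
  move=> q /(good_tripleP cert _ _ bN); have /(good_tripleP cert _ _ bN) -> := good_p.
  case: p q {good_p} => [[p1 p2] p3] [[q1 q2] q3] /= [e1 e2 e3].
  by congr (_, _, _); apply: val_inj.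
split=> [y|]; last first.
  by have := dimQP_std T_ok cert true t; rewrite size_std_mons.
split=> [[adm_y wy]|[x [p [j [adm_x wx good_p jp yE]]]]].
  have /std_mons2P[b [j [bN Jj ->]]] := (std_monsP T_ok cert wy).1 adm_y.
  have [p [good_p bits]] := triple_of b bN.
  have xN : mon 5 (b ++ nseq t (last [::] b)) \in std_mons T false t.
    by apply/std_mons1P; exists b.
  have wx := weight_std_mons xN.
  exists (mon 5 (b ++ nseq t (last [::] b))), p, j; split; [|exact: wx|exact: good_p| |].
  - exact: (std_monsP T_ok cert wx).2 xN.
  - by rewrite -bits.
  by rewrite mpolyXD mpolyXn; congr (_ * 'X_[_ *+ (2 ^ _)]); lia.
have /std_mons1P[b bN xE] := (std_monsP T_ok cert wx).1 adm_x.
have yN : y \in std_mons T true t.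
  apply/std_mons2P; exists b, j; split; first exact: bN.
    (* The given triple [p] is identified with the one computed from [b], so that [j] lies in the
       last letter of [b]. *)
    have [q [good_q ->]] := triple_of b bN; move: good_p; rewrite xE.
    move/(good_tripleP cert _ _ bN)=> pE; move/(good_tripleP cert _ _ bN): good_q.
    rewrite pE => -[e1 e2 e3]; move: jp; rewrite !inE -!val_eqE /= e1 e2 e3; apply: id.
  (* Both sides are single monomials; comparing coefficients at [y] turns the polynomial identity
     into one of exponents. *)
  apply/eqP; have := congr1 (mcoeff y) yE.
  rewrite xE mpolyXn -mpolyXD (_ : 8 + t - 2 = 6 + t)%N; last lia.
  by rewrite !mcoeffX eqxx eq_sym; case: eqP.
have wy := weight_std_mons yN.
by split; [exact: (std_monsP T_ok cert wy).2 yN | exact: wy].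
Qed.
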